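(* The Shortest Path with Forcing Graph problem admits a kernel with ${\mathcal O}(k^5)$ vertices and edges.
   Context: Shortest Path with Forcing Graph: the input is a simple, undirected, unweighted graph $G=(V,E)$, two distinct vertices $s,t\in V(G)$, a positive integer $k$, and a forcing graph $G_f=(E,E')$ whose vertex set is the edge set of $G$; both $G$ and $G_f$ are arbitrary. The question is whether there is a set $E^*\subseteq E$ of at most $k$ edges such that the subgraph $(V,E^* )$ contains an $s$-$t$ path and $E^*$ is a vertex cover of $G_f$. The parameter is $k$ (solution size). *)

(* Defs.v *)
From mathcomp Require Import all_boot.

Set Implicit Arguments.
Unset Strict Implicit.
Unset Printing Implicit Defensive.

(* Programs for a random-access machine, with structured control flow.

   The store is a family of arrays of natural numbers; a program names finitely
   many of them, and a scalar variable is a one-cell array.  The arithmetic is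
   only addition and truncated subtraction.  Every assignment and every test
   costs one step: an expression has constant size for a fixed program, and,
   as there is no multiplication, t steps produce numbers of at most O(t) bits
   more than those of the input, so that this cost is polynomially related to
   Turing machine time. *)

Definition store := nat -> nat -> nat.

Inductive expr :=
| Cst of nat
| Get of nat & expr          (* Get a i is the cell a[i] *)
| Add of expr & expr
| Sub of expr & expr.

Inductive cmd :=
| Skip
| Put of nat & expr & expr   (* Put a i e is a[i] := e *)
| Seq of cmd & cmd
| If of expr & cmd & cmd     (* a test succeeds when its value is not 0 *)
| While of expr & cmd.

Fixpoint eval (st : store) (e : expr) : nat :=
  match e with
  | Cst n => n
  | Get a i => st a (eval st i)
  | Add e1 e2 => eval st e1 + eval st e2
  | Sub e1 e2 => eval st e1 - eval st e2
  end.

Definition update (st : store) (a i v : nat) : store :=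
  fun b j => if (b == a) && (j == i) then v else st b j.

(* exec c st t st' : started in st, the program c halts in st' after t steps. *)
Inductive exec : cmd -> store -> nat -> store -> Prop :=
| exec_skip st : exec Skip st 1 st
| exec_put a i e st :
    exec (Put a i e) st 1 (update st a (eval st i) (eval st e))
| exec_seq c1 c2 st1 st2 st3 t1 t2 :
    exec c1 st1 t1 st2 -> exec c2 st2 t2 st3 ->
    exec (Seq c1 c2) st1 (t1 + t2) st3
| exec_if_true e c1 c2 st t st' :
    eval st e != 0 -> exec c1 st t st' -> exec (If e c1 c2) st t.+1 st'
| exec_if_false e c1 c2 st t st' :
    eval st e = 0 -> exec c2 st t st' -> exec (If e c1 c2) st t.+1 st'
| exec_while_true e c st1 st2 st3 t1 t2 :
    eval st1 e != 0 -> exec c st1 t1 st2 -> exec (While e c) st2 t2 st3 ->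
    exec (While e c) st1 (t1 + t2).+1 st3
| exec_while_false e c st :
    eval st e = 0 -> exec (While e c) st 1 st.

(* A word is stored in an array with its length in front.  The input is in
   array 0, every other cell being 0, and the output is read in array 1. *)
Definition initial_store (w : seq nat) : store :=
  fun a i => if a == 0 then nth 0 (size w :: w) i else 0.

Definition array_holds (arr : nat -> nat) (w : seq nat) : Prop :=
  forall i, i <= size w -> arr i = nth 0 (size w :: w) i.

(* Total length of the binary representations of the entries. *)
Definition bitsize (w : seq nat) : nat := \sum_(x <- w) (trunc_log 2 x).+1.

Definition poly_time (A B : Type) (encA : A -> seq nat) (encB : B -> seq nat)
    (f : A -> B) : Prop :=
  exists (p : cmd) (c d : nat), forall x : A, exists (t : nat) (st : store),
    [/\ exec p (initial_store (encA x)) t st,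
        array_holds (st 1) (encB (f x))
      & t <= c * bitsize (encA x) ^ d + c].

(* The parameter of an instance is [param], its size [measure].  As usual, the
   bound on the kernel applies to both the output and its parameter. *)
Definition admits_kernel (I : Type) (encode : I -> seq nat) (param : I -> nat)
    (yes : I -> Prop) (measure : I -> nat) (bound : nat -> nat) : Prop :=
  exists K : I -> I,
    [/\ poly_time encode encode K,
        forall x, yes x <-> yes (K x)
      & exists c : nat, forall x,
          measure (K x) + param (K x) <= c * bound (param x)].

Record sgraph (V : finType) := SGraph {
  adj : rel V;
  adj_sym : symmetric adj;
  adj_irr : irreflexive adj
}.

Definition edges (V : finType) (G : sgraph V) : {set {set V}} :=
  [set e | [exists x, exists y, adj G x y && (e == [set x; y])]].

Definition edge (V : finType) (G : sgraph V) := {e : {set V} | e \in edges G}.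

Definition vertex_cover (V : finType) (G : sgraph V) (S : {set V}) : Prop :=
  forall x y, adj G x y -> (x \in S) || (y \in S).

(* Adjacency in the subgraph with the same vertices and the edge set S. *)
Definition subgraph_adj (V : finType) (G : sgraph V) (S : {set edge G}) :
    rel V :=
  fun x y => [exists e in S, val e == [set x; y]].

Record spfg := SPFG {
  nvertices : nat;
  graph : sgraph 'I_nvertices;
  source : 'I_nvertices;
  target : 'I_nvertices;
  source_neq_target : source != target;
  budget : nat;
  budget_gt0 : 0 < budget;
  forcing : sgraph (edge graph)
}.

Definition spfg_yes (x : spfg) : Prop :=
  exists S : {set edge (graph x)},
    [/\ #|S| <= budget x,
        connect (subgraph_adj S) (source x) (target x)
      & vertex_cover (forcing x) S].

(* Since the vertices of the forcing graph are the edges of the graph, this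
   counts the vertices and the edges of both graphs. *)
Definition spfg_size (x : spfg) : nat :=
  nvertices x + #|edges (graph x)| + #|edges (forcing x)|.

(* The numbers n, s, t, k, the n x n adjacency matrix of the graph, and the
   n^2 x n^2 matrix which has a 1 in row (i, j) and column (i', j') when
   {i, j} and {i', j'} are adjacent in the forcing graph. *)
Definition spfg_encode (x : spfg) : seq nat :=
  let V := enum 'I_(nvertices x) in
  let V2 := [seq (i, j) | i <- V, j <- V] in
  [:: nvertices x; source x : nat; target x : nat; budget x]
  ++ [seq nat_of_bool (adj (graph x) p.1 p.2) | p <- V2]
  ++ [seq nat_of_bool [exists e, exists e',
         [&& val e == [set p.1; p.2], val e' == [set q.1; q.2]
           & adj (forcing x) e e']] | p <- V2, q <- V2].

(* Main.v *)
Require Import Defs.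
From mathcomp Require Import all_boot.
From mathcomp Require Import zify.
From Stdlib Require Import ClassicalEpsilon.

(* The kernel.  Let k' = min(k, n^2).  Scan the forcing edges and keep a pair
   (e, e') as long as e and e' have at most k' kept partners and at most
   k'(k' + 1) pairs are kept.  An edge with k' + 1 kept partners belongs to every
   cover of size k' of the kept pairs, and more than k'(k' + 1) kept pairs of
   degree at most k' + 1 have no such cover, so that the O(k'^2) kept pairs have
   the same covers of size at most k' as the forcing graph.  Let F be the O(k'^2)
   edges in kept pairs and T the O(k'^2) vertices among s, t and the ends of F.
   An s-t path in a solution splits at the vertices of T into edges of F and
   segments avoiding F; replacing each segment by a fixed shortest path between
   its ends does not increase the number of edges outside F.  Hence it suffices to
   retain F and one path of at most k' edges for each of the O(k'^4) pairs of T,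
   which leaves O(k'^5) edges.

   The running time.  The algorithm is written with loops "for i < n" only, where
   n is read from the input and never modified; the number of steps is then
   polynomial in n by the mere syntax of the program. *)

(** A solution has two duties, covering and connecting. Whether it covers the kept pairs depends
    only on its members in F, so these are never touched; the other members serve the connection
    alone, and the path can be replaced segment by segment without another look at the forcing
    graph. A replacement path may itself run through F, which does no harm.

    The forcing graph lives on a type that depends on the graph, so an instance and its kernel
    cannot be compared directly. Both are rephrased as a set of vertex sets with a relation on
    vertex sets, and the new vertices are related to the old ones by an injection.

    On the program side, invariants carry two lists that the store merely reflects: the kept pairs
    and the marked edges. The kernel is built from these lists, and the output is shown to be its
    encoding. As the lists come from existential statements, the kernel map is obtained by
    choice. *)

Set Implicit Arguments.
Unset Strict Implicit.
Unset Printing Implicit Defensive.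

(** * Loop programs *)

(* [PFor a p] runs p for a = 0, .., n - 1, where n is the cell 1 of the input, that
   is the number of vertices. *)
Inductive prog :=
| PPut of nat & expr & expr
| PSeq of prog & prog
| PWhen of expr & prog
| PFor of nat & prog.

Fixpoint compile (p : prog) : cmd :=
  match p with
  | PPut a i e => Put a i e
  | PSeq p q => Seq (compile p) (compile q)
  | PWhen e p => If e (compile p) Skip
  | PFor a p =>
    Seq (Put a (Cst 0) (Cst 0))
      (While (Defs.Sub (Get 0 (Cst 1)) (Get a (Cst 0)))
        (Seq (compile p) (Put a (Cst 0) (Add (Get a (Cst 0)) (Cst 1)))))
  end.

Fixpoint writes (p : prog) : seq nat :=
  match p with
  | PPut a _ _ => [:: a]
  | PSeq p q => writes p ++ writes q
  | PWhen _ p => writes p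
  | PFor a p => a :: writes p
  end.

(** Since array 0 is never written, the bound of every loop stays [n]; since a body leaves its own
    counter alone, the [While] loop stops after exactly [n] rounds. *)
Fixpoint wf (p : prog) : bool :=
  match p with
  | PPut a _ _ => a != 0
  | PSeq p q => wf p && wf q
  | PWhen _ p => wf p
  | PFor a p => [&& a != 0, a \notin writes p & wf p]
  end.

(** A total semantics: termination and time are settled once in [exec_run], and correctness is then
    a matter of equations on [run]. *)
Fixpoint run (p : prog) (st : store) : store :=
  match p with
  | PPut a i e => update st a (eval st i) (eval st e)
  | PSeq p q => run q (run p st)
  | PWhen e p => if eval st e != 0 then run p st else st
  | PFor a p =>
    iter (st 0 1) (fun s => update (run p s) a 0 (run p s a 0 + 1))
      (update st a 0 0)
  end.

(** A round pays for its test and its increment besides the body; the final 2 of a loop is the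
    initialization of the counter and the failing test. *)
Fixpoint cost (n : nat) (p : prog) : nat :=
  match p with
  | PPut _ _ _ => 1
  | PSeq p q => cost n p + cost n q
  | PWhen _ p => (cost n p).+2
  | PFor _ p => n * (cost n p + 2) + 2
  end.

Definition same (ws : seq nat) (s s' : store) :=
  forall b, b \notin ws -> s b = s' b.

Lemma update_neq st a i v b : b != a -> update st a i v b = st b.
Proof. by rewrite /update => /negbTE ->. Qed.

Lemma update_eq st a i v j :
  update st a i v a j = if j == i then v else st a j.
Proof. by rewrite /update eqxx. Qed.

Lemma run_same p st : same (writes p) (run p st) st.
Proof.
elim: p st => [a i e|p IHp q IHq|e p IHp|a p IHp] st b /=.
- by rewrite inE /update => /negbTE ->.
- by rewrite mem_cat negb_or => /andP[bp bq]; rewrite IHq // IHp.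
- by move=> bp; case: ifP => // _; apply: IHp.
rewrite inE negb_or => /andP[ba bp].
by elim: (st 0 1) => [|m IHm] /=; rewrite update_neq // IHp.
Qed.

Lemma wf_writes0 p : wf p -> 0 \notin writes p.
Proof.
elim: p => [a i e|p IHp q IHq|e p IHp|a p IHp] //=.
- by rewrite inE eq_sym.
- by case/andP=> /IHp ? /IHq ?; rewrite mem_cat negb_or; apply/andP.
by case/and3P=> a0 _ /IHp ?; rewrite inE negb_or eq_sym a0.
Qed.

Lemma exec_run p st : wf p ->
  exists2 t, exec (compile p) st t (run p st) & t <= cost (st 0 1) p.
Proof.
elim: p st => [a i e|p IHp q IHq|e p IHp|a p IHp] st /=.
- by exists 1; first constructor.
- case/andP=> wp wq.
  have [t1 e1 c1] := IHp st wp; have [t2 e2 c2] := IHq (run p st) wq.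
  exists (t1 + t2); first by econstructor; eauto.
  by apply: leq_add => //; rewrite run_same ?wf_writes0 in c2 *.
- move=> wp; have [t e1 c1] := IHp st wp; case: ifPn => [e0|/negPn/eqP e0].
    by exists t.+1; [constructor | lia].
  by exists 2; [apply: exec_if_false => //; constructor | lia].
case/and3P=> a0 ap wp.
pose f s := update (run p s) a 0 (run p s a 0 + 1).
set n := st 0 1; rewrite -/(f).
have fa s : f s a 0 = (s a 0).+1 by rewrite /f /update !eqxx /= run_same // addn1.
have f0 s : f s 0 = s 0.
  by rewrite /f /update eq_sym (negbTE a0) /= run_same // wf_writes0.
(* The induction is on the number [m] of rounds still to come, so it starts from an arbitrary value
   of the counter. *)
have loop m s : s 0 1 = n -> s a 0 + m = n ->
    exists2 t, exec (While (Defs.Sub (Get 0 (Cst 1)) (Get a (Cst 0)))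
        (Seq (compile p) (Put a (Cst 0) (Add (Get a (Cst 0)) (Cst 1)))))
        s t (iter m f s) & t <= m * (cost n p + 2) + 1.
  elim: m s => [|m IHm] s s0 sm.
    by exists 1 => //; apply: exec_while_false => /=; lia.
  have [t1 e1 c1] := IHp s wp.
  have [||t2 e2 c2] := IHm (f s); first by rewrite f0.
    by rewrite fa; lia.
  exists ((t1 + 1) + t2).+1; last by rewrite s0 in c1; lia.
  rewrite iterSr; apply: (exec_while_true (st2 := f s)) => //=; first by lia.
  by apply: exec_seq e1 _; apply: exec_put.
have [||t e1 c1] := loop n (update st a 0 0).
- by rewrite /update eq_sym (negbTE a0).
- by rewrite /update !eqxx.
exists (1 + t); last by lia.
by apply: exec_seq e1; apply: exec_put.
Qed.

(** The base [n.+1] is positive even for [n = 0], which makes powers monotone in the exponent and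
    lets bounds of two programs be merged. *)
Lemma cost_poly p : exists c d, forall n, cost n p <= c * n.+1 ^ d.
Proof.
have mono c d c' d' n : c <= c' -> d <= d' -> c * n.+1 ^ d <= c' * n.+1 ^ d'.
  by move=> cc dd; apply: leq_mul => //; apply: leq_pexp2l.
elim: p => [a i e|p [c1 [d1 H1]] q [c2 [d2 H2]]|e p [c [d H]]|a p [c [d H]]] /=.
- by exists 1, 0.
- exists (c1 + c2), (maxn d1 d2) => n; rewrite mulnDl.
  apply: leq_add; [apply: leq_trans (H1 n) _ | apply: leq_trans (H2 n) _].
    by apply: mono => //; apply: leq_maxl.
  by apply: mono => //; apply: leq_maxr.
- exists (c + 2), d => n.
  have p0 : 0 < n.+1 ^ d by rewrite expn_gt0.
  by rewrite mulnDl; have := H n; lia.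
exists (c + 2), d.+1 => n.
have p0 : 0 < n.+1 ^ d by rewrite expn_gt0.
have := H n; move: (cost n p) p0 => C; rewrite expnS; move: (n.+1 ^ d) => P; nia.
Qed.

Lemma run_seq p q s : run (PSeq p q) s = run q (run p s). Proof. by []. Qed.

Lemma run_put a i e s : run (PPut a i e) s = update s a (eval s i) (eval s e).
Proof. by []. Qed.

Lemma run_when e p s :
  run (PWhen e p) s = if eval s e != 0 then run p s else s.
Proof. by []. Qed.

(** The rule hands to each round the value of the counter and the fact that all arrays outside the
    writes are as before the loop. Thus [I] only has to describe what the loop changes, and must be
    insensitive to the counter. *)
Lemma run_for (I : nat -> store -> Prop) a p st :
    wf (PFor a p) -> (forall i s v, I i s -> I i (update s a 0 v)) ->
    (forall i s, i < st 0 1 -> same (a :: writes p) s st -> s a 0 = i ->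
       I i s -> I i.+1 (run p s)) ->
  I 0 st -> I (st 0 1) (run (PFor a p) st).
Proof.
move=> /= /and3P[a0 ap wp] Iu Istep I0; set n := st 0 1 in Istep *.
set f := fun s => _.
suff: forall m, m <= n ->
    let s := iter m f (update st a 0 0) in
    [/\ same (a :: writes p) s st, s a 0 = m & I m s].
  by move=> /(_ n (leqnn n)) [].
elim=> [|m IHm] lem /=.
  split; last exact: Iu.
    by move=> b; rewrite inE negb_or /update => /andP[/negbTE ->].
  by rewrite /update !eqxx.
have [Hs Ha HI] := IHm (ltnW lem); split.
- move=> b; rewrite inE negb_or /f /update => /andP[/negbTE ba bp].
  by rewrite ba /= run_same // Hs // inE ba.
- by rewrite /f /update !eqxx /= run_same // Ha addn1.
by apply: Iu; apply: Istep.
Qed.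

Arguments run : simpl never.

(** Here [g] is a ghost list reflected by the store through [J] and extended at its head. Round [i]
    achieves [H i], which later growth preserves, and extends the list by at most [w i]. *)
Lemma run_for_grow (A : eqType) (n : nat) (J : seq A -> store -> Prop)
    (w : 'I_n -> nat) (H : 'I_n -> seq A -> Prop) a p st g :
    st 0 1 = n -> wf (PFor a p) ->
    (forall g s v, J g s -> J g (update s a 0 v)) ->
    (forall i g g', suffix g g' -> H i g -> H i g') ->
    (forall (i : 'I_n) s g, same (a :: writes p) s st -> s a 0 = i -> J g s ->
       exists g', [/\ suffix g g', size g' <= size g + w i, H i g'
                     & J g' (run p s)]) ->
  J g st ->
  exists g', [/\ suffix g g', size g' <= size g + \sum_i w i,
                 forall i, H i g' & J g' (run (PFor a p) st)].
Proof.
move=> st01 wfp Ju Hm Hstep Jg.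
pose I m s := exists g', [/\ suffix g g',
  size g' <= size g + \sum_(i < n | i < m) w i,
  forall i : 'I_n, i < m -> H i g' & J g' s].
have: I (st 0 1) (run (PFor a p) st); last first.
  rewrite st01 => -[g' [sg zg Hg Jg']]; exists g'; split=> //.
    by rewrite (eq_bigl (fun i : 'I_n => i < n)) // => i; rewrite ltn_ord.
  by move=> i; apply: Hg; apply: ltn_ord.
apply: run_for => //.
- by move=> i s v [g' [? ? ? ?]]; exists g'; split=> //; apply: Ju.
- rewrite st01 => i s lti Hs Ha [g1 [sg1 zg1 Hg1 J1]].
  have [g2 [sg2 zg2 Hg2 J2]] := Hstep (Ordinal lti) s g1 Hs Ha J1.
  exists g2; split=> //; first exact: suffix_trans sg1 sg2.
    rewrite (bigD1 (Ordinal lti)) //= addnCA addnC.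
    apply: leq_trans zg2 _; rewrite leq_add2r; apply: leq_trans zg1 _.
    rewrite leq_add2l; apply: eq_leq; apply: eq_bigl => j.
    by rewrite ltnS -val_eqE /= andbC ltn_neqAle.
  move=> j; rewrite ltnS leq_eqVlt => /predU1P[ji|/Hg1]; last exact: Hm.
  by rewrite (_ : j = Ordinal lti) //; apply: val_inj.
by exists g; split=> //; apply: suffix_refl || apply: leq_addr.
Qed.

Fixpoint whens (es : seq expr) (p : prog) : prog :=
  if es is e :: es' then PWhen e (whens es' p) else p.

Lemma run_whens es p s :
  run (whens es p) s = if all (fun e => eval s e != 0) es then run p s else s.
Proof. by elim: es => //= e es IH; rewrite run_when; case: ifP. Qed.

(** * Sparsifying the forcing graph and rerouting paths *)

Section Sparsification.
Variable T : finType.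
Implicit Types (L : seq (T * T)) (e : T) (S : {set T}).

Definition incident e (c : T * T) := (c.1 == e) || (c.2 == e).

Definition degree L e := count (incident e) L.

Definition kept L : rel T := fun e e' => ((e, e') \in L) || ((e', e) \in L).

Fixpoint simple L : bool :=
  if L is c :: L' then [&& c.1 != c.2, ~~ kept L' c.1 c.2 & simple L'] else true.

(* The reason why (e, e') need not be added to the list L: for each clause, a set
   of size at most k which covers L contains e or e'. *)
Definition handled k L e e' :=
  [|| kept L e e', k < degree L e, k < degree L e' | k.+1 * k < size L].

Definition covers (f : rel T) S := forall e e', f e e' -> (e \in S) || (e' \in S).

Lemma keptC L e e' : kept L e e' = kept L e' e.
Proof. by rewrite /kept orbC. Qed.

Lemma suffix_count (a : pred (T * T)) L L' :
  suffix L L' -> count a L <= count a L'.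
Proof. by case/suffixP=> L1 ->; rewrite count_cat leq_addl. Qed.

Lemma suffix_size (A : eqType) (s s' : seq A) : suffix s s' -> size s <= size s'.
Proof. by case/suffixP=> L1 ->; rewrite size_cat leq_addl. Qed.

Lemma suffix_mem (A : eqType) (s s' : seq A) : suffix s s' -> {subset s <= s'}.
Proof. by case/suffixP=> L1 -> x xs; rewrite mem_cat xs orbT. Qed.

Lemma handled_suffix k L L' e e' :
  suffix L L' -> handled k L e e' -> handled k L' e e'.
Proof.
move=> sL; rewrite /handled /kept => /or4P[/orP[]/(suffix_mem sL)->|H|H|H].
- by [].
- by rewrite orbT.
- by rewrite (leq_trans H (suffix_count _ sL)) !orbT.
- by rewrite (leq_trans H (suffix_count _ sL)) !orbT.
by rewrite (leq_trans H (suffix_size sL)) !orbT.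
Qed.

Lemma simple_irr L e : simple L -> ~~ kept L e e.
Proof.
elim: L => //= -[a b] L IH /and3P[/= ab _ /IH]; rewrite /kept /= !inE !orbb.
by rewrite negb_or => ->; rewrite andbT; apply: contra ab => /eqP[-> ->].
Qed.

(** If [e] is outside the cover, the other end of each of its pairs is inside, and these ends are
    distinct because [L] has no repeated pair in either order. *)
Lemma degree_le_cover L S e :
  simple L -> covers (kept L) S -> e \notin S -> degree L e <= #|S|.
Proof.
move=> sL cS eS; pose other (c : T * T) := if c.1 == e then c.2 else c.1.
have otherS c : c \in L -> incident e c -> other c \in S.
  case: c => a b cL; have := cS a b; rewrite /kept cL => /(_ isT).
  rewrite /incident /other /=; case: eqP => [-> + _|_ /= + /eqP be].
    by rewrite (negbTE eS).
  by rewrite be (negbTE eS) orbF.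
have incK c : incident e c -> c = (e, other c) \/ c = (other c, e).
  case: c => a b; rewrite /incident /other /=.
  by case: eqP => [->|_ /eqP ->]; [left | right].
suff: uniq [seq other c | c <- L & incident e c].
  move=> /card_uniqP; rewrite size_map size_filter /degree => <-.
  apply/subset_leq_card/subsetP => x /mapP[c].
  by rewrite mem_filter => /andP[ic cL] ->; apply: otherS.
elim: L sL {cS otherS} => //= c L IH /and3P[_ nk /IH uL].
case: ifP => //= ic; rewrite uL andbT; apply: contra nk => /mapP[c'].
rewrite mem_filter => /andP[ic' c'L] oc; rewrite /kept.
have c'E : c' = (other c', e) \/ c' = (e, other c') by case: (incK _ ic'); auto.
by case: (incK _ ic) c'E => -> [] c'E; rewrite oc -c'E c'L ?orbT.
Qed.

(** Each pair is charged to one of its ends in [S]. *)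
Lemma size_le_cover L S d :
  covers (kept L) S -> (forall e, degree L e <= d) -> size L <= #|S| * d.
Proof.
move=> cS dL.
have: size L <= \sum_(e in S) degree L e.
  have: {in L, forall c, (c.1 \in S) || (c.2 \in S)}.
    by case=> a b cL; apply: cS; rewrite /kept cL.
  elim: L {cS dL} => //= c L IH HL.
  rewrite big_split /= -[(size L).+1]add1n leq_add //; last first.
    by apply: IH => c' c'L; apply: HL; rewrite inE c'L orbT.
  have /orP[cS|cS] := HL c (mem_head _ _).
    by rewrite (bigD1 c.1) //= /incident eqxx.
  by rewrite (bigD1 c.2) //= /incident eqxx orbT.
move/leq_trans; apply; rewrite -sum_nat_const.
by apply: leq_sum => e _; apply: dL.
Qed.

Lemma cover_handled k L S e e' :
    simple L -> (forall e, degree L e <= k.+1) -> covers (kept L) S -> #|S| <= k ->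
  handled k L e e' -> (e \in S) || (e' \in S).
Proof.
move=> sL dL cS Sk /or4P[/cS // | | |].
- case: (boolP (e \in S)) => // /(degree_le_cover sL cS) H1 H2.
  by move: (leq_trans H2 (leq_trans H1 Sk)); rewrite ltnn.
- case: (boolP (e' \in S)) => [|/(degree_le_cover sL cS) H1 H2].
    by rewrite orbT.
  by move: (leq_trans H2 (leq_trans H1 Sk)); rewrite ltnn.
move=> H; have := size_le_cover cS dL; nia.
Qed.

End Sparsification.

(** * Rerouting a path between terminals *)

Section Rerouting.
Variable V : finType.
Implicit Types (S E : {set {set V}}) (A : rel V).

Definition span S : rel V := fun u v => [set u; v] \in S.

(** Walks are extended at their far end, as are the segments in [reroute] and the walks in the
    relaxation of distances. *)
Fixpoint walk A l u v :=
  if l is l'.+1 then [exists w, walk A l' u w && A w v] else u == v.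

Definition steps (w : V) (p : seq V) := pairmap (fun a b => [set a; b]) w p.

Lemma sub_connect_span S S' u v :
  S \subset S' -> connect (span S) u v -> connect (span S') u v.
Proof.
by move/subsetP=> sS; apply: connect_sub => a b ab; apply/connect1/sS.
Qed.

Lemma steps_sub w p e : e \in steps w p -> {subset e <= w :: p}.
Proof.
elim: p w => //= v p IH w; rewrite inE => /predU1P[-> x|/IH H x /H].
  by rewrite !inE => /orP[]/eqP->; rewrite eqxx ?orbT.
by rewrite !inE => ->; rewrite orbT.
Qed.

Lemma uniq_steps w p : uniq (w :: p) -> uniq (steps w p).
Proof.
elim: p w => //= v p IH w /and3P[wp vp up]; rewrite IH /= ?vp // andbT.
by apply: contra wp => /steps_sub; apply; rewrite !inE eqxx.
Qed.

Lemma path_steps S w p : path (span S) w p = all (mem S) (steps w p).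
Proof. by elim: p w => //= v p IH w; rewrite IH. Qed.

Lemma size_steps w p : size (steps w p) = size p.
Proof. exact: size_pairmap. Qed.

Section Reroute.
Variables (A : rel V) (E M F S : {set {set V}}) (T : {set V}) (B : nat).
Hypotheses (EA : forall u v, [set u; v] \in E -> A u v) (SE : S \subset E).
Hypothesis (FT : forall u v, [set u; v] \in F -> u \in T).
Hypothesis link : forall u v l, u \in T -> v \in T -> l <= B -> walk A l u v ->
  exists S', [/\ S' \subset M, #|S'| <= l & connect (span S') u v].

(* The vertex u is the last one of T met so far and l the length of the segment
   from u to w; the edges of this segment outside F are paid for by l. *)
Lemma reroute p w u l :
    walk A l u w -> u \in T -> path (span S) w p -> last w p \in T ->
    l + size p <= B ->
  exists S', [/\ S' \subset M, #|S'| <= l + count (predC (mem F)) (steps w p)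
               & connect (span (S' :|: S :&: F)) u (last w p)].
Proof.
elim: p w u l => [|v p IH] w u l walk_uw uT /=.
  rewrite !addn0 => _ wT lB; have [S' [S'M S'l cS']] := link uT wT lB walk_uw.
  by exists S'; split=> //; apply: sub_connect_span cS'; apply: subsetUl.
move=> /andP[wv pv] lT; rewrite addnS => lB.
(* An edge of [F] is retained: the current segment is closed at [w] and an empty one opened at [v],
   both in [T] by [FT]. *)
case: (boolP ([set w; v] \in F)) => wvF.
  have wT : w \in T by apply: FT wvF.
  have vT : v \in T by rewrite setUC in wvF; apply: FT wvF.
  have [|S1 [S1M S1l cS1]] := link uT wT _ walk_uw; first by lia.
  have [|S2 [S2M S2l cS2]] := IH v v 0 (eqxx v) vT pv lT; first by lia.
  exists (S1 :|: S2); split; first by rewrite subUset S1M.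
    by rewrite add0n; apply: leq_trans (leq_card_setU _ _) _; apply: leq_add.
  apply: (@connect_trans _ _ w).
    by apply: sub_connect_span cS1; rewrite -setUA subsetUl.
  apply: (@connect_trans _ _ v).
    by apply: connect1; rewrite /span !inE wvF andbT -/(span S w v) wv !orbT.
  by apply: sub_connect_span cS2; rewrite -setUA subsetUr.
have [||S1 [S1M S1l cS1]] := IH v u l.+1 _ uT pv lT.
- by rewrite /=; apply/existsP; exists w; rewrite walk_uw EA // (subsetP SE).
- by lia.
by exists S1; split=> //; rewrite add1n addnS.
Qed.

Lemma reroute_all s t :
    s \in T -> t \in T -> minn #|S| #|V| <= B -> connect (span S) s t ->
  exists S', [/\ S' \subset M, #|S'| <= #|S :\: F|
               & connect (span (S' :|: S :&: F)) s t].
Proof.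
move=> sT tT SB /connectP[p0 path0 tE].
(* On a simple path the edges are distinct members of [S] and the vertices are distinct, so its
   length is bounded by both [#|S|] and [#|V|]. *)
have [p [path_p up tl]] :
    exists p, [/\ path (span S) s p, uniq (s :: p) & t = last s p].
  by rewrite tE; case: (shortenP path0) => p pp up _; exists p.
have uS := uniq_steps up; rewrite path_steps in path_p.
have pS : size p <= #|S|.
  rewrite -(size_steps s) -(card_uniqP uS).
  by apply/subset_leq_card/subsetP => e /(allP path_p).
have pV : size p <= #|V|.
  by have := max_card (mem (s :: p)); rewrite (card_uniqP up) /=; lia.
rewrite -path_steps in path_p.
have [||S1 [S1M S1l cS1]] := @reroute p s s 0 (eqxx s) sT path_p.
- by rewrite -tl.
- by lia.
exists S1; rewrite tl; split=> //; apply: leq_trans S1l _.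
rewrite add0n -size_filter -(card_uniqP (filter_uniq _ uS)).
apply/subset_leq_card/subsetP => e.
rewrite mem_filter !inE => /andP[/= -> /=].
by rewrite path_steps in path_p => /(allP path_p).
Qed.
End Reroute.
End Rerouting.

(** * Instances as relations on sets of vertices *)

Definition solution (V : finType) (E : {set {set V}}) (f : rel {set V})
    (s t : V) (k : nat) :=
  exists S : {set {set V}},
    [/\ S \subset E, #|S| <= k, connect (span S) s t & covers f S].

Definition touched (T : finType) (L : seq (T * T)) : {set T} :=
  [set e | 0 < degree L e].

Lemma touchedP (T : finType) (L : seq (T * T)) e :
  reflect (exists e', kept L e e') (e \in touched L).
Proof.
rewrite inE -has_count; apply: (iffP hasP) => [[[a b] cL]|[e' /orP[] H]].
- rewrite /incident /= => /orP[]/eqP<-; [exists b | exists a].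
    by rewrite /kept cL.
  by rewrite /kept cL orbT.
- by exists (e, e'); rewrite // /incident /= eqxx.
by exists (e', e); rewrite // /incident /= eqxx orbT.
Qed.

(** From left to right, [S :&: F] still covers the kept pairs, whose members all lie in [F], and the
    linking paths in [M] cost no more than [S :\: F]. From right to left, a cover of the kept pairs
    of size at most [minn k m] meets every handled pair. *)
Lemma solution_kernel (V : finType) (A : rel V) (E M : {set {set V}})
    (T : {set V}) (f : rel {set V}) (L : seq ({set V} * {set V})) s t k m :
    (forall u v, [set u; v] \in E -> A u v) -> M \subset E -> #|E| <= m ->
    symmetric f -> {in L, forall c, f c.1 c.2} -> simple L ->
    (forall e, degree L e <= (minn k m).+1) ->
    (forall e e', f e e' -> handled (minn k m) L e e') ->
    touched L \subset M -> s \in T -> t \in T ->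
    (forall u v, [set u; v] \in touched L -> u \in T) ->
    (forall u v l, u \in T -> v \in T -> l <= minn (minn k m) #|V| ->
       walk A l u v ->
       exists S' : {set {set V}},
         [/\ S' \subset M, #|S'| <= l & connect (span S') u v]) ->
  solution E f s t k <-> solution M (kept L) s t (minn k m).
Proof.
move=> EA ME Em fC fL sL dL hL FM sT tT FT link; split; last first.
  case=> S [SM Sk cS covS]; exists S; split=> //.
  - exact: subset_trans ME.
  - by apply: leq_trans Sk (geq_minl _ _).
  by move=> e e' /hL; apply: cover_handled.
case=> S [SE Sk cS covS]; set F := touched L in FM FT.
have Skm : #|S| <= minn k m.
  by rewrite leq_min Sk; apply: leq_trans Em; apply: subset_leq_card.
have [|S1 [S1M S1S cS1]] :=
  @reroute_all V A E M F S T (minn (minn k m) #|V|) EA SE FT link s t sT tT _ cS.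
  by lia.
exists (S1 :|: S :&: F); split=> //.
- rewrite subUset S1M; apply: subset_trans FM; apply: subsetIr.
- apply: leq_trans (leq_card_setU _ _) _; apply: leq_trans Skm.
  by rewrite -(cardsID F S) addnC leq_add2l.
have HF e e' : kept L e e' -> e \in F by move=> H; apply/touchedP; exists e'.
move=> e e' ee'; have /orP[eS|eS] : (e \in S) || (e' \in S).
- apply: covS; case/orP: ee' => /fL //=; by rewrite fC.
- by rewrite in_setU in_setI eS (HF _ _ ee') orbT.
by rewrite keptC in ee'; rewrite !in_setU !in_setI eS (HF _ _ ee') !orbT.
Qed.

(** Defined on arbitrary vertex sets, false on non-edges: this is the form of the entries of the
    encoded forcing matrix. *)
Definition forced (V : finType) (G : sgraph V) (H : sgraph (edge G)) :
    rel {set V} :=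
  fun e e' => [exists a, exists b, [&& val a == e, val b == e' & adj H a b]].

Lemma forcedC (V : finType) (G : sgraph V) (H : sgraph (edge G)) :
  symmetric (forced H).
Proof.
suff impl e e' : forced H e e' -> forced H e' e.
  by move=> e e'; apply/idP/idP; apply: impl.
case/existsP=> a /existsP[b /and3P[ea eb ab]].
by apply/existsP; exists b; apply/existsP; exists a; rewrite ea eb adj_sym ab.
Qed.

Lemma forced_irr (V : finType) (G : sgraph V) (H : sgraph (edge G)) e :
  forced H e e = false.
Proof.
apply/negbTE/existsP=> -[a /existsP[b /and3P[/eqP <- /eqP/val_inj ->]]].
by rewrite adj_irr.
Qed.

Lemma forced_edges (V : finType) (G : sgraph V) (H : sgraph (edge G)) e e' :
  forced H e e' -> e \in edges G.
Proof. by case/existsP=> a /existsP[b /and3P[/eqP <- _ _]]; apply: valP. Qed.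

Lemma forced_val (V : finType) (G : sgraph V) (H : sgraph (edge G)) a b :
  forced H (val a) (val b) = adj H a b.
Proof.
apply/existsP/idP => [[a' /existsP[b']]|ab].
  by case/and3P=> /eqP/val_inj -> /eqP/val_inj ->.
by exists a; apply/existsP; exists b; rewrite !eqxx.
Qed.

Lemma in_edges (V : finType) (G : sgraph V) u v :
  ([set u; v] \in edges G) = adj G u v.
Proof.
rewrite inE; apply/existsP/idP => [[x /existsP[y /andP[xy /eqP uv]]]|uv].
  have: x \in [set u; v] by rewrite uv set21.
  have: y \in [set u; v] by rewrite uv set22.
  rewrite !inE => /orP[]/eqP yE /orP[]/eqP xE; move: xy; rewrite xE yE ?adj_irr //.
  by rewrite adj_sym.
by exists u; apply/existsP; exists v; rewrite uv eqxx.
Qed.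

Lemma spfg_yesP (x : spfg) :
  spfg_yes x <->
  solution (edges (graph x)) (forced (forcing x)) (source x) (target x) (budget x).
Proof.
split=> [[S [Sk cS covS]]|[S [SE Sk cS covS]]].
  exists [set val e | e in S]; split.
  - by apply/subsetP=> _ /imsetP[e _ ->]; apply: valP.
  - exact: leq_trans (leq_imset_card _ _) Sk.
  - apply: connect_sub cS => u v /existsP[e /andP[eS /eqP ev]].
    by apply: connect1; rewrite /span -ev imset_f.
  move=> e e' /existsP[a /existsP[b /and3P[/eqP <- /eqP <- /covS]]].
  by case/orP=> /(imset_f val) ->; rewrite ?orbT.
exists [set e | val e \in S]; split.
- rewrite -(card_imset _ val_inj); apply: leq_trans Sk.
  by apply/subset_leq_card/subsetP=> _ /imsetP[e + ->]; rewrite inE.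
- apply: connect_sub cS => u v uv; apply: connect1; apply/existsP.
  exists (exist (fun e => e \in edges (graph x)) _ (subsetP SE _ uv)).
  by rewrite inE eqxx andbT.
by move=> a b ab; rewrite !inE; apply: covS; rewrite forced_val.
Qed.

Lemma card_edges n (G : sgraph 'I_n) : #|edges G| <= n * n.
Proof.
have <-: #|[set: 'I_n * 'I_n]| = n * n by rewrite cardsT card_prod card_ord.
apply: leq_trans (leq_imset_card (fun p : 'I_n * 'I_n => [set p.1; p.2]) _).
apply/subset_leq_card/subsetP => e; rewrite inE => /existsP[u /existsP[v]].
case/andP=> _ /eqP->; apply/imsetP; by exists (u, v).
Qed.

(** * Pulling an instance back along an injection of vertices *)

Section Restriction.
Variables (V : finType) (G : sgraph V) (M : {set {set V}}).
Variables (L : seq ({set V} * {set V})).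
Hypotheses (ME : M \subset edges G) (simpleL : simple L).
Hypothesis (LM : touched L \subset M).
Variables (n : nat) (f : 'I_n -> V).
Hypothesis (f_inj : injective f).
Hypothesis (fM : forall e v, e \in M -> v \in e -> v \in codom f).

Let rel_f : rel 'I_n := fun i j => [set f i; f j] \in M.

Fact rel_f_sym : symmetric rel_f.
Proof. by move=> i j; rewrite /rel_f setUC. Qed.

Fact rel_f_irr : irreflexive rel_f.
Proof.
by move=> i; apply/negP=> /(subsetP ME); rewrite in_edges adj_irr.
Qed.

Definition restricted_graph := SGraph rel_f_sym rel_f_irr.

Let rel_L : rel (edge restricted_graph) :=
  fun a b => kept L (f @: val a) (f @: val b).

Fact rel_L_sym : symmetric rel_L.
Proof. by move=> a b; rewrite /rel_L keptC. Qed.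

Fact rel_L_irr : irreflexive rel_L.
Proof. by move=> a; apply/negbTE/simple_irr. Qed.

Definition restricted_forcing := SGraph rel_L_sym rel_L_irr.

Lemma edges_restricted e : (e \in edges restricted_graph) = (f @: e \in M).
Proof.
rewrite inE; apply/existsP/idP => [[i /existsP[j /andP[/= ij /eqP->]]]|eM].
  by rewrite imsetU1 imset_set1.
have := subsetP ME _ eM; rewrite inE => /existsP[u /existsP[v /andP[uv /eqP ev]]].
have /codomP[i iE] : u \in codom f by apply: fM eM _; rewrite ev set21.
have /codomP[j jE] : v \in codom f by apply: fM eM _; rewrite ev set22.
exists i; apply/existsP; exists j; rewrite /= /rel_f -iE -jE -ev eM /=.
by rewrite -(inj_eq (imset_inj f_inj)) imsetU1 imset_set1 -iE -jE ev.
Qed.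

Lemma forced_restricted e e' :
  forced restricted_forcing e e' = kept L (f @: e) (f @: e').
Proof.
apply/existsP/idP => [[a /existsP[b /and3P[/eqP<- /eqP<-]]]//|ee'].
have eE : e \in edges restricted_graph.
  by rewrite edges_restricted (subsetP LM) //; apply/touchedP; exists (f @: e').
have e'E : e' \in edges restricted_graph.
  rewrite edges_restricted (subsetP LM) //; apply/touchedP; exists (f @: e).
  by rewrite keptC.
pose P (e : {set 'I_n}) := e \in edges restricted_graph.
exists (exist P e eE); apply/existsP; exists (exist P e' e'E).
by rewrite /= !eqxx.
Qed.

Lemma imset_preimset e : e \in M -> f @: (f @^-1: e) = e.
Proof.
move=> eM; apply/setP=> v; apply/imsetP/idP => [[i + ->]|ve]; first by rewrite inE.
by have /codomP[i iE] := fM eM ve; exists i; rewrite // inE -iE.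
Qed.

(** Solutions are carried over by images and preimages under [f]. A path in [M] that starts in the
    image of [f] stays there, because each further vertex lies on an edge of [M]. *)
Lemma solution_restricted s t k :
  solution (edges restricted_graph) (forced restricted_forcing) s t k <->
  solution M (kept L) (f s) (f t) k.
Proof.
split=> [[S [SE Sk cS covS]]|[S [SM Sk cS covS]]].
  exists [set f @: e | e : {set _} in S]; split.
  - by apply/subsetP=> _ /imsetP[e eS ->]; rewrite -edges_restricted (subsetP SE).
  - exact: leq_trans (leq_imset_card _ _) Sk.
  - have /connectP[p] := cS; elim: p (s) => [|j p IH] i /= => [_ ->//|/andP[ij pj] tE].
    apply: connect_trans (IH j pj tE); apply: connect1; apply/imsetP.
    by exists [set i; j]; rewrite // imsetU1 imset_set1.
  move=> e e' ee'.
  have eM : e \in M by apply: (subsetP LM); apply/touchedP; exists e'.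
  have e'M : e' \in M.
    by apply: (subsetP LM); apply/touchedP; exists e; rewrite keptC.
  have := covS (f @^-1: e) (f @^-1: e').
  rewrite forced_restricted !imset_preimset // => /(_ ee').
  by case/orP=> H; apply/orP; [left|right]; apply/imsetP;
    [exists (f @^-1: e) | exists (f @^-1: e')]; rewrite ?imset_preimset.
exists [set e : {set 'I_n} | f @: e \in S]; split.
- by apply/subsetP=> e; rewrite inE edges_restricted => /(subsetP SM).
- rewrite -(card_imset _ (imset_inj f_inj)); apply: leq_trans Sk.
  by apply/subset_leq_card/subsetP=> _ /imsetP[e + ->]; rewrite inE.
- have /connectP[p] := cS.
  elim: p (s) => [|v p IH] i /= => [_ /f_inj->//|/andP[iv pv] tE].
  have /codomP[j jE] : v \in codom f by apply: fM (subsetP SM _ iv) _; rewrite set22.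
  rewrite jE in pv tE iv; apply: connect_trans (IH j pv tE); apply: connect1.
  by rewrite /span inE imsetU1 imset_set1.
by move=> e e'; rewrite forced_restricted !inE => /covS.
Qed.

Lemma card_edges_restricted : #|edges restricted_graph| <= #|M|.
Proof.
rewrite -(card_imset _ (imset_inj f_inj)); apply/subset_leq_card/subsetP.
by move=> _ /imsetP[e + ->]; rewrite edges_restricted.
Qed.

Lemma card_edges_restricted_forcing : #|edges restricted_forcing| <= size L.
Proof.
pose h (a : edge restricted_graph) := f @: val a.
pose g (E : {set edge restricted_graph}) := h @: E.
have g_inj : injective g by apply: imset_inj => a b /(imset_inj f_inj)/val_inj.
rewrite -(card_imset _ g_inj).
apply: (@leq_trans #|[set [set c.1; c.2] | c in [set c in L]]|); last first.
  by apply: leq_trans (leq_imset_card _ _) _; rewrite cardsE card_size.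
apply/subset_leq_card/subsetP=> _ /imsetP[E + ->].
rewrite inE => /existsP[a /existsP[b /andP[ab /eqP->]]].
rewrite /g imsetU1 imset_set1; case/orP: ab => H; apply/imsetP.
  by exists (h a, h b); rewrite ?inE.
by exists (h b, h a); rewrite ?inE //= setUC.
Qed.

End Restriction.

(** * The program: tables and input *)

(* Names of arrays.  R1, R2, R3 tabulate the multiples of n, n^2, n^3, from which
   the indices of matrix entries are computed without multiplication. *)
Notation R1 := 2. Notation R2 := 3. Notation R3 := 4.
Notation N2 := 6. Notation N3 := 7. Notation N4 := 8.
Notation KP := 9. Notation CAP := 10.
Notation KEPT := 11. Notation DEG := 12. Notation CNT := 13.
Notation MARK := 14. Notation USED := 15. Notation TERM := 16.
Notation DIST := 17. Notation PAR := 18. Notation CUR := 19.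
Notation EA := 20. Notation EB := 21.
Notation LEN := 22. Notation NV := 23. Notation SI := 24. Notation TI := 25.
Notation X := 30. Notation Y := 31. Notation Z := 32. Notation W := 33.
Notation U := 34. Notation R := 35.

Definition var a := Get a (Cst 0).
Definition skip := PWhen (Cst 0) (PPut 1 (Cst 0) (Cst 0)).
Definition seqs : seq prog -> prog := foldr PSeq skip.
Arguments seqs : simpl never.
Definition set_var a e := PPut a (Cst 0) e.

Lemma run_seqs p ps s : run (seqs (p :: ps)) s = run (seqs ps) (run p s).
Proof. by []. Qed.

Lemma run_seqs0 s : run (seqs [::]) s = s.
Proof. by []. Qed.

Definition idx2 x y := Add (Get R1 x) y.
Definition idx4 x y z w := Add (Add (Get R3 x) (Get R2 y)) (idx2 z w).

(** The offset 5 skips the length of the word and the four numbers ahead of the matrix. *)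
Definition adj_expr x y := Get 0 (Add (Cst 5) (idx2 x y)).
Definition forced_expr x y z w := Get 0 (Add (Add (Cst 5) (var N2)) (idx4 x y z w)).

Definition table r acc step :=
  PSeq (set_var acc (Cst 0))
    (PFor X (PSeq (PPut r (var X) (var acc)) (set_var acc (Add (var acc) step)))).

(** With truncated subtraction [a - (a - b)] is the minimum of [a] and [b]. The product in [CAP] is
    a repeated addition: [KP + 1] is added in the first [KP] of the [n * n] rounds. *)
Definition initialize := seqs
  [:: table R1 N2 (Get 0 (Cst 1)); table R2 N3 (var N2); table R3 N4 (var N3);
      set_var KP (Defs.Sub (Get 0 (Cst 4)) (Defs.Sub (Get 0 (Cst 4)) (var N2)));
      set_var CAP (Cst 1);
      PFor X (PFor Y (PWhen (Defs.Sub (var KP) (idx2 (var X) (var Y)))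
        (set_var CAP (Add (var CAP) (Add (var KP) (Cst 1))))))].

Lemma table_spec n r acc step m s :
    s 0 1 = n -> uniq [:: 0; r; acc; X] ->
    (forall s', same [:: r; acc; X] s' s -> eval s' step = m) ->
  (forall i, i < n -> run (table r acc step) s r i = m * i)
  /\ run (table r acc step) s acc 0 = m * n.
Proof.
move=> s01; rewrite /= !inE !negb_or -!andbA => /and5P[r0 a0 _ ra].
case/and3P=> rX aX _ Hstep.
pose I j s' := (forall i, i < j -> s' r i = m * i) /\ s' acc 0 = m * j.
rewrite /table run_seq; set s1 := run _ s.
have s1E : same [:: r; acc; X] s1 s.
  by move=> b; rewrite !inE !negb_or => /and3P[_ ba _]; apply: update_neq.
have s101 : s1 0 1 = n by rewrite s1E // !inE !negb_or r0 a0.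
rewrite -s101; apply: (@run_for I).
- rewrite /= !inE !negb_or ![_ == r]eq_sym ![_ == acc]eq_sym rX aX.
  by rewrite eq_sym r0 eq_sym a0.
- move=> i s2 v; rewrite /I !update_neq //.
- move=> i s2 lti Hs sX [H1 H2].
  rewrite run_seq [run (PPut _ _ _) _]/run; set s3 := update _ _ _ _.
  have s3acc : s3 acc = s2 acc by rewrite /s3 update_neq // eq_sym.
  have s3step : eval s3 step = m.
    apply: Hstep => b; rewrite !inE !negb_or => /and3P[br ba bX].
    rewrite /s3 update_neq // Hs; last by rewrite /= !inE !negb_or br ba bX.
    by rewrite s1E // !inE !negb_or br ba bX.
  rewrite /set_var [run _ _]/run /=; split.
    move=> j; rewrite ltnS update_neq // /s3 /update eqxx /= sX.
    case: eqP => [->|/eqP ji jlei]; first by rewrite H2.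
    by apply: H1; rewrite ltn_neqAle ji.
  by rewrite /update !eqxx /= s3step s3acc H2 mulnS addnC.
by split=> //; rewrite muln0 /s1 /set_var /run /update !eqxx.
Qed.

Lemma nth_allpairs (A B C : Type) (f : A -> B -> C) a0 b0 c0 s t i j :
    i < size s -> j < size t ->
  nth c0 [seq f a b | a <- s, b <- t] (size t * i + j) = f (nth a0 s i) (nth b0 t j).
Proof.
move=> + jt; elim: s i => //= a s IH [_|i it] /=; rewrite nth_cat size_map.
  by rewrite muln0 add0n jt (nth_map b0).
rewrite mulnS -addnA ltnNge leq_addr /= addKn; exact: IH.
Qed.

Lemma eq_idx2 n (i j i' j' : nat) : j < n -> j' < n ->
  (n * i + j == n * i' + j') = (i == i') && (j == j').
Proof.
move=> jn jn'; apply/eqP/andP => [E|[/eqP-> /eqP->] //].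
have n0 : 0 < n by apply: leq_trans jn.
have := congr1 (divn^~ n) E; rewrite /= ![n * _]mulnC !divnMDl // !divn_small //.
by rewrite !addn0 => Ei; move: E; rewrite Ei => /addnI ->; rewrite !eqxx.
Qed.

Section Input.
Variable x : spfg.
Let n := nvertices x.
Notation A := (adj (graph x)).
Notation fx := (forced (forcing x)).
Notation input := (initial_store (spfg_encode x) 0).
(** There are at most [n * n] edges, so lowering the budget to this value preserves the answer; it
    also keeps the budget within reach of loops over pairs of vertices. *)
Definition kappa := minn (budget x) (n * n).
(** The first size at which the last clause of [handled] holds for every pair; no pair is kept
    beyond it. *)
Definition cap := (kappa.+1 * kappa).+1.

Lemma input_n : input 1 = n. Proof. by []. Qed.
Lemma input_s : input 2 = source x. Proof. by []. Qed.
Let V2 := [seq (i, j) | i <- enum 'I_n, j <- enum 'I_n].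

Let size_V2 : size V2 = n * n.
Proof. by rewrite size_allpairs size_enum_ord. Qed.

Let nth_V2 p0 (i j : 'I_n) : nth p0 V2 (n * i + j) = (i, j).
Proof.
have := @nth_allpairs _ _ _ (@pair 'I_n 'I_n) i j p0 (enum 'I_n) (enum 'I_n) i j.
by rewrite size_enum_ord !nth_ord_enum => ->.
Qed.

Let lt_idx (i j : 'I_n) : n * i + j < n * n.
Proof. have := ltn_ord i; have := ltn_ord j; nia. Qed.

Lemma input_adj (i j : 'I_n) : input (5 + (n * i + j)) = A i j.
Proof.
rewrite /initial_store /= nth_cat size_map size_V2 lt_idx.
by rewrite add0n (nth_map (i, j)) ?nth_V2 // size_V2 lt_idx.
Qed.

Lemma input_forced (i j i' j' : 'I_n) :
  input (5 + n * n + (n * n * n * i + n * n * j + (n * i' + j'))) =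
  fx [set i; j] [set i'; j'].
Proof.
rewrite /initial_store -addnA /= add0n nth_cat size_map size_V2.
rewrite ltnNge leq_addr /= addKn.
rewrite (_ : n * n * n * i + n * n * j = n * n * (n * i + j)); last first.
  by rewrite mulnDr mulnA.
rewrite -{1}size_V2 (nth_allpairs _ (i, j) (i, j)) ?size_V2 ?lt_idx //.
by rewrite (nth_V2 (i, j) i j) (nth_V2 (i, j) i' j').
Qed.

Record base (s : store) : Prop := Base {
  baseI : s 0 = input;
  baseR1 : forall i, i < n -> s R1 i = n * i;
  baseR2 : forall i, i < n -> s R2 i = n * n * i;
  baseR3 : forall i, i < n -> s R3 i = n * n * n * i;
  baseN2 : s N2 0 = n * n;
  baseKP : s KP 0 = kappa;
  baseCAP : s CAP 0 = cap }.

Lemma base_n s : base s -> s 0 1 = n.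
Proof. by case=> ->. Qed.

(** The side condition is a closed boolean for a given program, so the tables are carried through
    each phase by computation. *)
Lemma base_same ws s s' : same ws s s' ->
  all (fun b => b \notin ws) [:: 0; R1; R2; R3; N2; KP; CAP] -> base s' -> base s.
Proof.
move=> Hs /= /and5P[/Hs H0 /Hs H2 /Hs H3 /Hs H4 /and4P[/Hs H6 /Hs H9 /Hs H10 _]].
by case=> *; split; rewrite ?H0 ?H2 ?H3 ?H4 ?H6 ?H9 ?H10.
Qed.

Lemma initialize_base s : s 0 = input -> base (run initialize s).
Proof.
move=> s0; rewrite /initialize !run_seqs run_seqs0.
set s1 := run (table R1 _ _) s; have f1 : same _ s1 s := @run_same _ _.
have [H1 H1'] : (forall i, i < n -> s1 R1 i = n * i) /\ s1 N2 0 = n * n.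
  apply: table_spec => //; first by rewrite s0.
  by move=> s' /(_ 0 isT) /= ->; rewrite s0.
set s2 := run _ s1; have f2 : same _ s2 s1 := @run_same _ _.
have [H2 H2'] : (forall i, i < n -> s2 R2 i = n * n * i) /\ s2 N3 0 = n * n * n.
  apply: table_spec => //; first by rewrite f1 // s0.
  by move=> s' /(_ N2 isT) /= ->.
set s3 := run _ s2; have f3 : same _ s3 s2 := @run_same _ _.
have [H3 _] : (forall i, i < n -> s3 R3 i = n * n * n * i) /\ s3 N4 0 = n * n * n * n.
  apply: table_spec => //; first by rewrite f2 // f1 // s0.
  by move=> s' /(_ N3 isT) /= ->.
have E0 : s3 0 = input by rewrite f3 // f2 // f1 // s0.
have E1 i : i < n -> s3 R1 i = n * i by rewrite f3 // f2 //; apply: H1.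
have E2 i : i < n -> s3 R2 i = n * n * i by rewrite f3 //; apply: H2.
have E6 : s3 N2 0 = n * n by rewrite f3 // f2.
set s4 := run (set_var KP _) s3; have f4 : same _ s4 s3 := @run_same _ _.
have E9 : s4 KP 0 = kappa.
  rewrite /s4 /set_var run_put /update /= E0 E6 /initial_store /= /kappa -/n; lia.
set s5 := run (set_var CAP _) s4; have f5 : same _ s5 s4 := @run_same _ _.
have E10 : s5 CAP 0 = 1 by [].
set s6 := run _ s5; have f6 : same _ s6 s5 := @run_same _ _.
have s501 : s5 0 1 = n by rewrite f5 // f4 // E0.
split.
- by rewrite f6 // f5 // f4.
- by move=> i lti; rewrite f6 // f5 // f4 // E1.
- by move=> i lti; rewrite f6 // f5 // f4 // E2.
- by move=> i lti; rewrite f6 // f5 // f4 // H3.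
- by rewrite f6 // f5 // f4.
- by rewrite f6 // f5.
have kap2 : kappa <= n * n by apply: geq_minr.
(* The inner test compares [kappa] with the number of cells already visited, so after [i] rows it
   has succeeded [minn (n * i) kappa] times. *)
pose I i s' := s' CAP 0 = 1 + kappa.+1 * minn (n * i) kappa.
have: I (s5 0 1) s6; last first.
  by rewrite s501 /I => ->; rewrite (minn_idPr kap2).
apply: run_for => //; last by rewrite /I muln0 min0n muln0.
rewrite s501 => i s7 lti f7 s7X I7.
pose J j s' := s' CAP 0 = s7 CAP 0 + kappa.+1 * minn j (kappa - n * i).
have s701 : s7 0 1 = n by rewrite f7.
suff: J (s7 0 1) (run (PFor Y (PWhen (Defs.Sub (var KP) (idx2 (var X) (var Y)))
        (set_var CAP (Add (var CAP) (Add (var KP) (Cst 1)))))) s7).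
  rewrite s701 /J /I I7 => ->; rewrite -addnA -mulnDr; congr (_ + _ * _).
  rewrite mulnS; lia.
apply: run_for => //; last by rewrite /J min0n muln0 addn0.
rewrite s701 => j s8 ltj f8 s8Y I8; rewrite run_when /=.
have E8R : s8 R1 i = n * i by rewrite f8 // f7 // f5 // f4 // E1.
have E8K : s8 KP 0 = kappa by rewrite f8 // f7 // f5.
have E8X : s8 X 0 = i by rewrite f8.
rewrite s8Y E8X E8R E8K; case: ifPn => H; rewrite /J.
  rewrite /set_var run_put /update /= I8 E8K -addnA addn1 -mulnSr; congr (_ + _ * _).
  by move: H; lia.
by rewrite I8; congr (_ + _ * _); move: H; lia.
Qed.

End Input.

(** * The program: selecting forcing edges *)

(** An edge is represented by its increasing pair of ends only, so that it owns a single cell of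
    [DEG]. The two orders of a pair of edges are both looked up in [KEPT]. *)
Definition greedy_tests :=
  [:: Defs.Sub (var Y) (var X); Defs.Sub (var W) (var Z);
      forced_expr (var X) (var Y) (var Z) (var W);
      Defs.Sub (Cst 1) (Add (Get KEPT (idx4 (var X) (var Y) (var Z) (var W)))
                            (Get KEPT (idx4 (var Z) (var W) (var X) (var Y))));
      Defs.Sub (Add (var KP) (Cst 1)) (Get DEG (idx2 (var X) (var Y)));
      Defs.Sub (Add (var KP) (Cst 1)) (Get DEG (idx2 (var Z) (var W)));
      Defs.Sub (var CAP) (var CNT)].

Definition greedy_keep := seqs
  [:: PPut KEPT (idx4 (var X) (var Y) (var Z) (var W)) (Cst 1);
      PPut DEG (idx2 (var X) (var Y)) (Add (Get DEG (idx2 (var X) (var Y))) (Cst 1));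
      PPut DEG (idx2 (var Z) (var W)) (Add (Get DEG (idx2 (var Z) (var W))) (Cst 1));
      set_var CNT (Add (var CNT) (Cst 1))].

Definition greedy :=
  PFor X (PFor Y (PFor Z (PFor W (whens greedy_tests greedy_keep)))).

Lemma eq_set2 m (i j a b : 'I_m) : i < j -> a < b ->
  ([set i; j] == [set a; b]) = (i == a) && (j == b).
Proof.
move=> ij ab; apply/eqP/andP => [E|[/eqP-> /eqP->] //].
have : i \in [set a; b] by rewrite -E set21.
have : j \in [set a; b] by rewrite -E set22.
have : a \in [set i; j] by rewrite E set21.
have : b \in [set i; j] by rewrite E set22.
rewrite !inE -!val_eqE /=; lia.
Qed.

Section Greedy.
Variable x : spfg.
Let n := nvertices x.
Notation fx := (forced (forcing x)).
Notation kap := (kappa x).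

Definition ix2 (i j : nat) := n * i + j.
Definition ix4 (i j i' j' : nat) := n * n * n * i + n * n * j + (n * i' + j').

Lemma ix4E i j i' j' : ix4 i j i' j' = n * n * ix2 i j + ix2 i' j'.
Proof. by rewrite /ix4 /ix2 mulnDr mulnA. Qed.

Lemma eq_ix2 (i j i' j' : 'I_n) :
  (ix2 i j == ix2 i' j') = (i == i') && (j == j').
Proof. exact: eq_idx2. Qed.

Lemma eq_ix4 (i j i' j' a b a' b' : 'I_n) :
  (ix4 i j i' j' == ix4 a b a' b') = [&& i == a, j == b, i' == a' & j' == b'].
Proof.
have lt (u v : 'I_n) : ix2 u v < n * n.
  have := ltn_ord u; have := ltn_ord v; rewrite /ix2; nia.
by rewrite !ix4E eq_idx2 ?lt // !eq_ix2 -andbA.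
Qed.

Lemma eval_idx2 s ex ey (i j : 'I_n) : base x s ->
  eval s ex = i -> eval s ey = j -> eval s (idx2 ex ey) = ix2 i j.
Proof. by move=> bs /= -> ->; rewrite (baseR1 bs). Qed.

Lemma eval_idx4 s ex ey ez ew (i j i' j' : 'I_n) : base x s ->
    eval s ex = i -> eval s ey = j -> eval s ez = i' -> eval s ew = j' ->
  eval s (idx4 ex ey ez ew) = ix4 i j i' j'.
Proof.
by move=> bs /= -> -> -> ->; rewrite (baseR1 bs) ?(baseR2 bs) ?(baseR3 bs).
Qed.

Lemma eval_adj s ex ey (i j : 'I_n) : base x s ->
    eval s ex = i -> eval s ey = j ->
  eval s (adj_expr ex ey) = adj (graph x) i j.
Proof.
move=> bs ei ej; rewrite -input_adj -(baseI bs) /adj_expr.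
by rewrite -[n * i + j]/(ix2 i j) -(eval_idx2 bs ei ej).
Qed.

Lemma eval_forced s ex ey ez ew (i j i' j' : 'I_n) : base x s ->
    eval s ex = i -> eval s ey = j -> eval s ez = i' -> eval s ew = j' ->
  eval s (forced_expr ex ey ez ew) = fx [set i; j] [set i'; j'].
Proof.
move=> bs ei ej ei' ej'; rewrite -input_forced -(baseI bs) /forced_expr.
have := eval_idx4 bs ei ej ei' ej'; rewrite /ix4 => <- /=.
by rewrite (baseN2 bs).
Qed.

Record greedy_inv (L : seq ({set 'I_n} * {set 'I_n})) (s : store) : Prop :=
  GreedyInv {
  gi_simple : simple L;
  gi_forced : {in L, forall c, fx c.1 c.2};
  gi_degree : forall e, degree L e <= kap.+1;
  gi_size : size L <= cap x;
  gi_KEPT : forall i j i' j' : 'I_n, s KEPT (ix4 i j i' j') =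
    [&& i < j, i' < j' & ([set i; j], [set i'; j']) \in L];
  gi_DEG : forall i j : 'I_n, s DEG (ix2 i j) =
    if i < j then degree L [set i; j] else 0;
  gi_CNT : s CNT 0 = size L }.

Definition greedy_done (i j i' j' : 'I_n) L :=
  i < j -> i' < j' -> fx [set i; j] [set i'; j'] ->
  handled kap L [set i; j] [set i'; j'].

Lemma greedy_body (i j i' j' : 'I_n) L s : base x s -> greedy_inv L s ->
    s X 0 = i -> s Y 0 = j -> s Z 0 = i' -> s W 0 = j' ->
  exists L', [/\ suffix L L', size L' <= size L + 1, greedy_done i j i' j' L'
               & greedy_inv L' (run (whens greedy_tests greedy_keep) s)].
Proof.
move=> bs J sX sY sZ sW; rewrite run_whens.
have Ep : eval s (idx2 (var X) (var Y)) = ix2 i j by apply: eval_idx2.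
have Eq : eval s (idx2 (var Z) (var W)) = ix2 i' j' by apply: eval_idx2.
have Epq : eval s (idx4 (var X) (var Y) (var Z) (var W)) = ix4 i j i' j'.
  by apply: eval_idx4.
have Eqp : eval s (idx4 (var Z) (var W) (var X) (var Y)) = ix4 i' j' i j.
  by apply: eval_idx4.
have Ef : eval s (forced_expr (var X) (var Y) (var Z) (var W)) =
    fx [set i; j] [set i'; j'] by apply: eval_forced.
have testE : all (fun e => eval s e != 0) greedy_tests =
  [&& i < j, i' < j', fx [set i; j] [set i'; j'],
      ~~ kept L [set i; j] [set i'; j'], degree L [set i; j] <= kap,
      degree L [set i'; j'] <= kap & size L <= kap.+1 * kap].
  move: Epq Eqp Ep Eq Ef => /= -> -> -> -> ->.
  rewrite sX sY sZ sW !(gi_KEPT J) !(gi_DEG J) (gi_CNT J) (baseKP bs) (baseCAP bs).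
  rewrite /cap /kept !subn_eq0 -!ltnNge !ltnS andbT.
  case: ltnP => //= ij; case: ltnP => //= ij'.
  rewrite !addn1 !ltnS; case: (fx _ _) => //=.
  by case: (_ \in L); case: (_ \in L).
case: ifPn; rewrite testE; last first.
  move=> H; exists L; split=> //; first exact: suffix_refl; first exact: leq_addr.
  move=> ij ij' fij; move: H; rewrite ij ij' fij /handled /= !negb_and negbK.
  by rewrite -!ltnNge.
case/and5P=> ij ij' fij nk /and3P[dp dq zL].
set c := ([set i; j], [set i'; j']).
(* As the two edges differ, their cells in [DEG] differ, and the first increment does not disturb
   the second. *)
have c12 : [set i; j] != [set i'; j'].
  by apply: contraTneq fij => ->; rewrite forced_irr.
have degE e : degree (c :: L) e = ([set i; j] == e) || ([set i'; j'] == e) + degree L e.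
  by [].
exists (c :: L); split.
- exact: suffix_cons.
- by rewrite addn1.
- by move=> *; rewrite /handled /kept mem_head.
rewrite /greedy_keep !run_seqs run_seqs0 !run_put.
set s1 := update s _ _ _; set s2 := update s1 _ _ _; set s3 := update s2 _ _ _.
have b1 : base x s1.
  by apply: (base_same (ws := [:: KEPT])) bs => // b; rewrite inE; apply: update_neq.
have b2 : base x s2.
  by apply: (base_same (ws := [:: DEG])) b1 => // b; rewrite inE; apply: update_neq.
have s2E : eval s1 (idx2 (var X) (var Y)) = ix2 i j by apply: eval_idx2.
have s3E : eval s2 (idx2 (var Z) (var W)) = ix2 i' j' by apply: eval_idx2.
split.
- by rewrite /= c12 nk (gi_simple J).
- by move=> c'; rewrite inE => /predU1P[->|/(gi_forced J)].
- move=> e; rewrite degE; case: eqP => [<-|_] /=; first by rewrite add1n ltnS.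
  by case: eqP => [<-|_]; rewrite ?add1n ?ltnS // add0n (gi_degree J).
- by rewrite /= /cap ltnS.
- move=> a b a' b'; rewrite update_neq // /s3 /s2 !update_neq // /s1 update_eq.
  rewrite Epq eq_ix4 (gi_KEPT J).
  case: (ltnP a b) => ab /=; last first.
    rewrite (_ : _ && _ = false) //; apply/negbTE/negP => /and4P[/eqP E1 /eqP E2 _ _].
    by move: ij; rewrite -E1 -E2 ltnNge ab.
  case: (ltnP a' b') => ab' /=; last first.
    rewrite (_ : _ && _ = false) //; apply/negbTE/negP => /and4P[_ _ /eqP E1 /eqP E2].
    by move: ij'; rewrite -E1 -E2 ltnNge ab'.
  by rewrite inE -pair_eqE /= !eq_set2 // !andbA; case: ifP.
- move=> a b; rewrite update_neq // /s3 update_eq s3E.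
  rewrite {2}/s2 update_eq s2E.
  have D1 : eval s1 (Get DEG (idx2 (var X) (var Y))) = degree L [set i; j].
    rewrite -[LHS]/(s1 DEG (eval s1 (idx2 (var X) (var Y)))) s2E.
    by rewrite /s1 update_neq // (gi_DEG J) ij.
  have D2 : eval s2 (Get DEG (idx2 (var Z) (var W))) = degree L [set i'; j'].
    rewrite -[LHS]/(s2 DEG (eval s2 (idx2 (var Z) (var W)))) s3E /s2 update_eq s2E.
    by rewrite /s1 update_neq // eq_ix2 (gi_DEG J) ij' ifN // -eq_set2 // eq_sym.
  have addE s' e : eval s' (Add e (Cst 1)) = (eval s' e).+1 by rewrite /= addn1.
  rewrite !addE D1 D2 !eq_ix2 /s1 update_neq // (gi_DEG J) degE.
  case: (ltnP a b) => ab; last first.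
    rewrite !ifN //; apply: contraTN ab => /andP[/eqP-> /eqP->]; by rewrite -ltnNge.
  rewrite -!(eq_set2 ab) // ![_ == [set a; b]]eq_sym.
  case: eqP => [E|_]; case: eqP => [E'|_] //; last by rewrite E'.
    by rewrite -E -E' eqxx in c12.
  by rewrite E.
by rewrite update_eq [LHS]/= /s3 /s2 /s1 !update_neq // (gi_CNT J) addn1.
Qed.

(** Each of the four nested loops takes one application of [run_for_grow], whose [H] quantifies over
    the indices of the loops inside. *)
Lemma greedyW (i j i' : 'I_n) L s : base x s -> greedy_inv L s ->
    s X 0 = i -> s Y 0 = j -> s Z 0 = i' ->
  exists L', [/\ suffix L L', size L' <= size L + \sum_(j' < n) 1,
      forall j', greedy_done i j i' j' L'
    & greedy_inv L' (run (PFor W (whens greedy_tests greedy_keep)) s)].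
Proof.
move=> bs J sX sY sZ; apply: run_for_grow J => //; first exact: base_n bs.
- by move=> L1 s1 v [? ? ? ? ? ? ?]; split.
- by move=> j' L1 L2 sL H ij ij' f; apply: handled_suffix sL (H ij ij' f).
move=> j' s1 L1 Hs s1W J1.
by apply: greedy_body => //; rewrite ?Hs //; apply: base_same Hs _ bs.
Qed.

Lemma greedyZ (i j : 'I_n) L s : base x s -> greedy_inv L s ->
    s X 0 = i -> s Y 0 = j ->
  exists L', [/\ suffix L L', size L' <= size L + \sum_(i' < n) \sum_(j' < n) 1,
      forall i' j', greedy_done i j i' j' L'
    & greedy_inv L' (run (PFor Z (PFor W (whens greedy_tests greedy_keep))) s)].
Proof.
move=> bs J sX sY.
apply: (run_for_grow (H := fun i' L => forall j', greedy_done i j i' j' L)) J => //.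
- exact: base_n bs.
- by move=> L1 s1 v [? ? ? ? ? ? ?]; split.
- by move=> i' L1 L2 sL H j' ij ij' f; apply: handled_suffix sL (H j' ij ij' f).
move=> i' s1 L1 Hs s1Z J1.
by apply: greedyW => //; rewrite ?Hs //; apply: base_same Hs _ bs.
Qed.

Lemma greedyY (i : 'I_n) L s : base x s -> greedy_inv L s -> s X 0 = i ->
  exists L', [/\ suffix L L',
      size L' <= size L + \sum_(j < n) \sum_(i' < n) \sum_(j' < n) 1,
      forall j i' j', greedy_done i j i' j' L'
    & greedy_inv L'
        (run (PFor Y (PFor Z (PFor W (whens greedy_tests greedy_keep)))) s)].
Proof.
move=> bs J sX.
apply: (run_for_grow (H := fun j L => forall i' j', greedy_done i j i' j' L)) J => //.
- exact: base_n bs.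
- by move=> L1 s1 v [? ? ? ? ? ? ?]; split.
- by move=> j L1 L2 sL H i' j' ij ij' f; apply: handled_suffix sL (H i' j' ij ij' f).
move=> j s1 L1 Hs s1Y J1.
by apply: greedyZ => //; rewrite ?Hs //; apply: base_same Hs _ bs.
Qed.

Lemma greedy_spec s : base x s -> greedy_inv [::] s ->
  exists L, (forall i j i' j', greedy_done i j i' j' L) /\
    greedy_inv L (run greedy s).
Proof.
move=> bs J.
suff [L [_ _ H JL]] : exists L, [/\ suffix [::] L,
    size L <= size (Nil ({set 'I_n} * {set 'I_n})) +
      \sum_(i < n) \sum_(j < n) \sum_(i' < n) \sum_(j' < n) 1,
    forall i j i' j', greedy_done i j i' j' L & greedy_inv L (run greedy s)].
  by exists L.
apply: (run_for_grow (H := fun i L => forall j i' j', greedy_done i j i' j' L)) J => //.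
- exact: base_n bs.
- by move=> L1 s1 v [? ? ? ? ? ? ?]; split.
- move=> i L1 L2 sL H j i' j' ij ij' f.
  by apply: handled_suffix sL (H j i' j' ij ij' f).
move=> i s1 L1 Hs s1X J1.
by apply: greedyY => //; apply: base_same Hs _ bs.
Qed.

End Greedy.

(** * The program: marking edges *)

Definition mark := seqs
  [:: PPut MARK (idx2 (var EA) (var EB)) (Cst 1);
      PPut MARK (idx2 (var EB) (var EA)) (Cst 1);
      PPut USED (var EA) (Cst 1); PPut USED (var EB) (Cst 1)].

Definition mark_ends :=
  seqs [:: PPut USED (Get 0 (Cst 2)) (Cst 1); PPut USED (Get 0 (Cst 3)) (Cst 1)].

Definition mark_touched :=
  PFor X (PFor Y (PWhen (Get DEG (idx2 (var X) (var Y)))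
    (seqs [:: set_var EA (var X); set_var EB (var Y); mark]))).

(** A snapshot: [links] goes on to enlarge [USED], while the set of terminals must stay fixed for
    the count of paths to hold. *)
Definition copy_terminals := PFor X (PPut TERM (var X) (Get USED (var X))).

Definition relax := whens
  [:: adj_expr (var X) (var Y);
      Defs.Sub (Get DIST (var Y)) (Add (Get DIST (var X)) (Cst 1))]
  (seqs [:: PPut DIST (var Y) (Add (Get DIST (var X)) (Cst 1));
            PPut PAR (var Y) (var X)]).

(** The Bellman-Ford method, with [kappa + 1] as infinity. No assignment is made from such a vertex,
    since no value of [DIST] exceeds [kappa + 1]. *)
Definition distances := seqs
  [:: PFor Y (PPut DIST (var Y) (Add (var KP) (Cst 1)));
      PPut DIST (var U) (Cst 0);
      PFor R (PFor X (PFor Y relax))].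

Definition trace_step :=
  PWhen (Get DIST (var CUR))
    (seqs [:: set_var EA (var CUR); set_var EB (Get PAR (var CUR)); mark;
              set_var CUR (var EB)]).

(** The second test discards vertices at infinity; the third ensures that [n] rounds of [trace_step]
    lead back to the vertex in [U]. *)
Definition trace := whens
  [:: Get TERM (var Z);
      Defs.Sub (Add (var KP) (Cst 1)) (Get DIST (var Z));
      Defs.Sub (Add (Get 0 (Cst 1)) (Cst 1)) (Get DIST (var Z))]
  (seqs [:: set_var CUR (var Z); PFor W trace_step]).

Definition links :=
  PFor U (PWhen (Get TERM (var U)) (seqs [:: distances; PFor Z trace])).

Section Marking.
Variable x : spfg.
Let n := nvertices x.
Notation G := (graph x).
Notation A := (adj G).
Notation kap := (kappa x).
Notation ix2 := (@ix2 x).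

Record mark_inv (ML : seq {set 'I_n}) (s : store) : Prop := MarkInv {
  mi_MARK : forall a b : 'I_n, s MARK (ix2 a b) = ([set a; b] \in ML);
  mi_USED : forall a : 'I_n, s USED a =
    [|| a == source x, a == target x | has (fun e : {set 'I_n} => a \in e) ML];
  mi_edges : {subset ML <= edges G} }.

Lemma eq_mark_inv ML ML' s : ML =i ML' -> mark_inv ML s -> mark_inv ML' s.
Proof.
move=> E [H1 H2 H3]; split=> [a b|a|e]; first by rewrite H1 E.
  by rewrite H2 (eq_has_r E).
by rewrite -E; apply: H3.
Qed.

Lemma mark_spec ML s (a b : 'I_n) : base x s -> mark_inv ML s -> A a b ->
  s EA 0 = a -> s EB 0 = b -> mark_inv ([set a; b] :: ML) (run mark s).
Proof.
move=> bs J ab sa sb; rewrite /mark !run_seqs run_seqs0 !run_put.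
set s1 := update s _ _ _; set s2 := update s1 _ _ _; set s3 := update s2 _ _ _.
have b1 : base x s1.
  by apply: (base_same (ws := [:: MARK])) bs => // c; rewrite inE; apply: update_neq.
have E1 : eval s (idx2 (var EA) (var EB)) = ix2 a b by apply: eval_idx2.
have E2 : eval s1 (idx2 (var EB) (var EA)) = ix2 b a by apply: eval_idx2.
have set2E (i j : 'I_n) : ([set i; j] == [set a; b]) =
    (ix2 i j == ix2 a b) || (ix2 i j == ix2 b a).
  rewrite !eq_ix2; apply/eqP/orP => [E|[]/andP[/eqP-> /eqP->] //]; last exact: setUC.
  have abn : a != b by apply: contraTneq ab => ->; rewrite adj_irr.
  have : i \in [set a; b] by rewrite -E set21.
  have : j \in [set a; b] by rewrite -E set22.
  have : a \in [set i; j] by rewrite E set21.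
  have : b \in [set i; j] by rewrite E set22.
  rewrite !inE ![_ == i]eq_sym ![_ == j]eq_sym; move: abn.
  by do 4!case: eqP => //= ?; subst; rewrite ?eqxx //; auto.
split=> [i j|i|e].
- rewrite !update_neq // /s3 update_neq // /s2 update_eq E2 /s1 update_eq E1.
  by rewrite (mi_MARK J) inE set2E; case: (_ == ix2 a b); case: (_ == ix2 b a).
- rewrite update_eq /s3 update_eq.
  rewrite [eval s2 _]/= [eval _ (var EB)]/= /s2 !update_neq // /s1 !update_neq //.
  rewrite sa sb (mi_USED J) /= !inE -!val_eqE /=.
  by case: (val i == b); case: (val i == a); rewrite ?orbT.
by rewrite inE => /predU1P[->|/(mi_edges J)//]; rewrite in_edges.
Qed.

Lemma mark_ends_spec s : base x s -> (forall i, s USED i = 0) ->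
  (forall i, s MARK i = 0) -> mark_inv [::] (run mark_ends s).
Proof.
move=> bs sU sM; rewrite /mark_ends !run_seqs run_seqs0 !run_put.
split=> // [a b|a]; first by rewrite !update_neq.
rewrite update_eq [eval _ (Get _ _)]/= update_neq // update_eq [eval _ _]/=.
rewrite (baseI bs) /= sU -!val_eqE.
rewrite /initial_store /= orbF.
rewrite (baseI bs) input_s. by case: (val a == target x); case: (val a == source x).
Qed.

Section Touched.
Variable L : seq ({set 'I_n} * {set 'I_n}).
Hypothesis LE : {subset touched L <= edges G}.

Let J ML s := [/\ mark_inv ML s, {subset ML <= touched L} &
  forall i j : 'I_n, s DEG (ix2 i j) = if i < j then degree L [set i; j] else 0].

Lemma mark_touched_spec s : base x s -> J [::] s ->
  mark_inv (enum (touched L)) (run mark_touched s).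
Proof.
move=> bs J0.
pose done (i j : 'I_n) (ML : seq {set 'I_n}) :=
  i < j -> [set i; j] \in touched L -> [set i; j] \in ML.
have doneS i j ML ML' : suffix ML ML' -> done i j ML -> done i j ML'.
  by move=> sM H ij /(H ij); apply: suffix_mem.
have Ju a : a != MARK -> a != USED -> a != DEG ->
    forall g s v, J g s -> J g (update s a 0 v).
  move=> a1 a2 a3 g s1 v [[? ? ?] ? ?].
  by split=> //; first split=> //; rewrite update_neq // eq_sym.
suff [ML [_ _ H [JM MT _]]] : exists ML, [/\ suffix [::] ML,
    size ML <= size (Nil {set 'I_n}) + \sum_(i < n) \sum_(j < n) 1,
    forall i j, done i j ML & J ML (run mark_touched s)].
  apply: eq_mark_inv JM => e; rewrite mem_enum; apply/idP/idP; first exact: MT.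
  move=> eL; have := LE eL; rewrite inE => /existsP[i /existsP[j /andP[ij /eqP eE]]].
  rewrite eE in eL *; case: (ltngtP i j) => [lt|lt|/val_inj E].
  - exact: H.
  - by rewrite setUC; apply: H => //; rewrite setUC.
  by rewrite E adj_irr in ij.
apply: (run_for_grow (H := fun i ML => forall j, done i j ML)) J0 => //.
- exact: base_n bs.
- exact: Ju.
- by move=> i ML ML' sM H j; apply: doneS sM (H j).
move=> i s1 ML1 Hs s1X J1.
have bs1 : base x s1 by apply: base_same Hs _ bs.
apply: run_for_grow J1 => //.
- exact: base_n bs1.
- exact: Ju.
- by move=> j ML ML' sM; apply: doneS.
move=> j s2 ML2 Hs2 s2Y J2.
have bs2 : base x s2 by apply: base_same Hs2 _ bs1.
have s2X : s2 X 0 = i by rewrite Hs2.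
have [JM MT DE] := J2.
rewrite run_when -[eval _ _]/(s2 DEG (eval s2 (idx2 (var X) (var Y)))).
rewrite (@eval_idx2 _ _ (var X) (var Y) i j) // DE; case: (ltnP i j) => ij; last first.
  exists ML2; split=> //; [exact: suffix_refl | exact: leq_addr|].
  by rewrite /done ltnNge ij.
case: eqP => [d0|/eqP d0] /=.
  exists ML2; split=> //; [exact: suffix_refl | exact: leq_addr|].
  by rewrite /done inE d0.
have ijT : [set i; j] \in touched L by rewrite inE lt0n.
exists ([set i; j] :: ML2); split.
- exact: suffix_cons.
- by rewrite addn1.
- by rewrite /done mem_head.
rewrite 3!run_seqs run_seqs0 /set_var 2!run_put; set s3 := update _ EB _ _.
have fr b : b != EA -> b != EB -> s3 b = s2 b by move=> b1 b2; rewrite /s3 !update_neq.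
have bs3 : base x s3.
  apply: (base_same (ws := [:: EA; EB])) bs2 => // b.
  by rewrite !inE negb_or => /andP[? ?]; apply: fr.
have JM3 : mark_inv ML2 s3 by case: JM => *; split=> *; rewrite ?fr.
split.
- apply: mark_spec => //.
  by rewrite -in_edges; apply: LE.
- by move=> e; rewrite inE => /predU1P[->|/MT].
move=> i' j'; by rewrite run_same // fr // DE.
Qed.

End Touched.
End Marking.

(** * The program: shortest paths *)

Section Links.
Variable x : spfg.
Let n := nvertices x.
Notation G := (graph x).
Notation A := (adj G).
Notation kap := (kappa x).
Notation ix2 := (@ix2 x).

Section Distances.
Variable u : 'I_n.

(* DIST only decreases, so a strict bound on DIST at the parent persists until the
   parent changes. *)
Record dist_inv (s : store) : Prop := DistInv {
  di_source : s DIST u = 0;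
  di_parent : forall y : 'I_n, s DIST y <= kap -> y != u ->
    exists z : 'I_n, [/\ s PAR y = z, A z y & s DIST z < s DIST y] }.

Lemma dist_inv_var a v s :
  a != DIST -> a != PAR -> dist_inv s -> dist_inv (update s a 0 v).
Proof.
rewrite ![a == _]eq_sym => a1 a2 [H1 H2].
by split=> [|y]; rewrite !update_neq //; apply: H2.
Qed.

Lemma relax_spec s (i j : 'I_n) : base x s -> dist_inv s ->
    s X 0 = i -> s Y 0 = j ->
  [/\ dist_inv (run relax s),
      forall y : 'I_n, run relax s DIST y <= s DIST y
    & A i j -> run relax s DIST j <= (s DIST i).+1].
Proof.
move=> bs J sX sY; rewrite /relax run_whens.
have Ea : eval s (adj_expr (var X) (var Y)) = A i j by apply: eval_adj.
rewrite [all _ _]/= -[s 0 _]/(eval s (adj_expr (var X) (var Y))) Ea sX sY andbT.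
case: (boolP (A i j)) => /= ij; last by split.
rewrite subn_eq0 -ltnNge addn1.
case: ltnP => lt; last by split.
rewrite !run_seqs run_seqs0 !run_put.
set s1 := update s _ _ _.
have s1D (y : 'I_n) : s1 DIST y = if y == j then (s DIST i).+1 else s DIST y.
  by rewrite /s1 update_eq /= sX sY addn1.
have EP : eval s1 (var Y) = j by rewrite /= /s1 update_neq.
have EX : eval s1 (var X) = i by rewrite /= /s1 update_neq.
rewrite EP EX; set s2 := update s1 _ _ _.
have s2D (y : 'I_n) : s2 DIST y = if y == j then (s DIST i).+1 else s DIST y.
  by rewrite -s1D /s2 update_neq.
have mono (y : 'I_n) : s2 DIST y <= s DIST y.
  by rewrite s2D; case: eqP => // ->; apply: ltnW.
have ju : j != u by apply: contraTneq lt => ->; rewrite (di_source J).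
split=> //; last by rewrite s2D eqxx.
split; first by rewrite s2D eq_sym (negbTE ju) (di_source J).
move=> y yk yu; case: (eqVneq y j) => [yj|yj].
  exists i; split; [by rewrite yj /s2 update_eq eqxx|by rewrite yj|].
  by rewrite yj [in X in _ < X]s2D eqxx ltnS mono.
rewrite s2D (negbTE yj) in yk *; have [z [Pz Az lz]] := di_parent J yk yu.
exists z; split=> //; last exact: leq_ltn_trans (mono z) lz.
by rewrite /s2 update_eq val_eqE (negbTE yj) /s1 update_neq.
Qed.

Lemma relax_from_spec s (i : 'I_n) : base x s -> dist_inv s -> s X 0 = i ->
  let s' := run (PFor Y relax) s in
  [/\ dist_inv s', forall y : 'I_n, s' DIST y <= s DIST y
    & forall y : 'I_n, A i y -> s' DIST y <= (s DIST i).+1].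
Proof.
move=> bs J sX; set s' := run _ s.
pose I j s' := [/\ dist_inv s', forall y : 'I_n, s' DIST y <= s DIST y
  & forall y : 'I_n, y < j -> A i y -> s' DIST y <= (s DIST i).+1].
have [J1 J2 J3] : I (s 0 1) s'; last first.
  by split=> // y; apply: J3; rewrite (base_n bs) ltn_ord.
apply: (@run_for I) => //.
  by move=> j s1 v [? ? ?]; split=> //; apply: dist_inv_var.
rewrite (base_n bs) => j s1 ltj Hs s1Y [J1 J2 J3].
have bs1 : base x s1 by apply: base_same Hs _ bs.
have s1X : s1 X 0 = i by rewrite Hs.
have [K1 K2 K3] := @relax_spec s1 i (Ordinal ltj) bs1 J1 s1X s1Y.
split=> // y; first exact: leq_trans (K2 y) (J2 y).
rewrite ltnS leq_eqVlt => /predU1P[yj|yj] iy; last first.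
  exact: leq_trans (K2 y) (J3 y yj iy).
have E : y = Ordinal ltj by apply: val_inj.
by rewrite E in iy *; apply: leq_trans (K3 iy) _; rewrite ltnS J2.
Qed.

Lemma relax_all_spec s : base x s -> dist_inv s ->
  let s' := run (PFor X (PFor Y relax)) s in
  [/\ dist_inv s', forall y : 'I_n, s' DIST y <= s DIST y
    & forall i y : 'I_n, A i y -> s' DIST y <= (s DIST i).+1].
Proof.
move=> bs J; set s' := run _ s.
pose I j s' := [/\ dist_inv s', forall y : 'I_n, s' DIST y <= s DIST y
  & forall i y : 'I_n, i < j -> A i y -> s' DIST y <= (s DIST i).+1].
have [J1 J2 J3] : I (s 0 1) s'; last first.
  by split=> // i y; apply: J3; rewrite (base_n bs) ltn_ord.
apply: (@run_for I) => //.
  by move=> j s1 v [? ? ?]; split=> //; apply: dist_inv_var.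
rewrite (base_n bs) => j s1 ltj Hs s1X [J1 J2 J3].
have bs1 : base x s1 by apply: base_same Hs _ bs.
have [K1 K2 K3] := @relax_from_spec s1 (Ordinal ltj) bs1 J1 s1X.
split=> // [y|i y]; first exact: leq_trans (K2 y) (J2 y).
rewrite ltnS leq_eqVlt => /predU1P[ij|ij] iy; last first.
  exact: leq_trans (K2 y) (J3 i y ij iy).
have E : i = Ordinal ltj by apply: val_inj.
by rewrite E in iy *; apply: leq_trans (K3 y iy) _; rewrite ltnS J2.
Qed.

Lemma distances_spec s : base x s -> s U 0 = u ->
  let s' := run distances s in
  dist_inv s' /\
  forall l (y : 'I_n), l <= n -> walk A l u y -> s' DIST y <= l.
Proof.
move=> bs sU; rewrite /distances 3!run_seqs run_seqs0.
set s1 := run (PFor Y _) s.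
have f1 : same _ s1 s := @run_same _ _.
have s1D (y : 'I_n) : s1 DIST y = kap.+1.
  pose I j s' := forall y : 'I_n, y < j -> s' DIST y = kap.+1.
  suff H : I (s 0 1) s1 by apply: H; rewrite (base_n bs) ltn_ord.
  apply: (@run_for I) => // j s2 ltj Hs s2Y J y'; rewrite ltnS leq_eqVlt run_put.
  rewrite update_eq [eval _ (var _)]/= s2Y.
  case: eqP => [_ _|_ /J //] /=.
  by rewrite Hs // (baseKP bs) addn1.
set s2 := run _ s1.
have f2 : same _ s2 s1 := @run_same _ _.
have s2D (y : 'I_n) : s2 DIST y = if y == u then 0 else kap.+1.
  by rewrite /s2 run_put update_eq /= f1 // sU s1D.
have bs2 : base x s2 by apply: base_same f2 _ (base_same f1 _ bs).
(* At this point the clause on parents is vacuous, every vertex but [u] being at infinity. *)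
have J2 : dist_inv s2.
  by split=> [|y]; rewrite s2D ?eqxx // => + /negbTE yu; rewrite yu ltnn.
set s' := run _ s2.
pose I r s' := dist_inv s' /\
  forall l (y : 'I_n), l <= r -> walk A l u y -> s' DIST y <= l.
suff: I (s2 0 1) s' by rewrite (base_n bs2).
apply: (@run_for I) => //.
- by move=> r s3 v [J3 H3]; split=> //; apply: dist_inv_var.
- rewrite (base_n bs2) => r s3 ltr Hs s3R [J3 H3].
  have bs3 : base x s3 by apply: base_same Hs _ bs2.
  have [K1 K2 K3] := relax_all_spec bs3 J3; split=> // l y.
  case: l => [_ /eqP<-|l lr /= /existsP[z /andP[uz zy]]].
    by rewrite (di_source K1).
  by apply: leq_trans (K3 z y zy) _; rewrite ltnS; apply: H3.
by split=> // l y; rewrite leqn0 => /eqP-> /eqP<-; rewrite (di_source J2).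
Qed.

Definition reach (D : nat -> nat) (z : 'I_n) (ML : seq {set 'I_n}) :=
  D z <= kap -> D z <= n -> exists S : {set {set 'I_n}},
    [/\ {subset S <= ML}, #|S| <= D z & connect (span S) u z].

(** Two one-sided facts do the work of exact distances: strict decrease of [DIST] along parents
    bounds the traced edges by [DIST z], and [distances_spec] bounds [DIST z] by the length of each
    walk of at most [n] steps. *)
Lemma trace_spec s ML (z : 'I_n) : base x s -> dist_inv s -> mark_inv ML s ->
    s Z 0 = z ->
  exists ML', [/\ suffix ML ML',
    size ML' <= size ML + (if s TERM z != 0 then kap else 0),
    s TERM z != 0 -> reach (s DIST) z ML' & mark_inv ML' (run trace s)].
Proof.
move=> bs J JM sZ; rewrite /trace run_whens [all _ _]/= sZ (baseKP bs) (baseI bs).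
rewrite input_n -/n andbT !subn_eq0 -!ltnNge !addn1 !ltnS.
set test := [&& _, _ & _]; case: (boolP test) => [/and3P[Tz Dk Dn]|H]; last first.
  exists ML; split=> //; [exact: suffix_refl|exact: leq_addr|].
  by move=> Tz Dk Dn; rewrite /test Tz Dk Dn in H.
rewrite Tz 2!run_seqs run_seqs0; set s1 := run _ s.
have f1 : same _ s1 s := @run_same _ _.
have bs1 : base x s1 by apply: base_same f1 _ bs.
pose D := s DIST; pose P := s PAR.
(* [D c] is a potential: each edge added to [S] and to the list is paid for by its decrease. After
   [n] rounds it is 0, as [D z <= n], and then [c] is [u], for any other vertex would have a parent
   of smaller value. *)
pose I i (s' : store) := exists ML' (c : 'I_n) (S : {set {set 'I_n}}),
  [/\ s' CUR 0 = c, D c = 0 \/ D c + i <= D z, D c <= kap,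
      [/\ suffix ML ML', size ML' + D c <= size ML + D z & mark_inv ML' s']
    & [/\ {subset S <= ML'}, #|S| + D c <= D z & connect (span S) c z]].
have: I (s1 0 1) (run (PFor W trace_step) s1).
  apply: (@run_for I) => //.
  - move=> i s2 v [ML' [c [S [? ? ? [? ? [? ? ?]] ?]]]].
    by exists ML', c, S; split=> //; split=> //.
  - rewrite (base_n bs1) => i s2 lti Hs _ [ML2 [c [S]]].
    case=> sc Dc Dck [sM zM M2] [SM zS cS].
    have D2 : s2 DIST = D by rewrite Hs // f1.
    have P2 : s2 PAR = P by rewrite Hs // f1.
    have bs2 : base x s2 by apply: base_same Hs _ bs1.
    rewrite /trace_step run_when [eval _ _]/= sc D2.
    case: ifPn => [Dc0|/negPn/eqP Dc0]; last first.
      by exists ML2, c, S; split=> //; left.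
    have cu : c != u by apply: contraNneq Dc0 => ->; rewrite /D (di_source J).
    have [c' [Pc Ac lc]] := di_parent J Dck cu.
    rewrite 4!run_seqs run_seqs0 /set_var 3!run_put.
    set s3 := update _ EB _ _.
    have f3 : same [:: EA; EB] s3 s2.
      by move=> b; rewrite !inE negb_or => /andP[b1 b2]; rewrite /s3 !update_neq.
    have M3 : mark_inv ML2 s3 by case: M2 => *; split=> *; rewrite ?f3.
    have sA : s3 EA 0 = c by rewrite /s3 /update /= sc.
    have sB : s3 EB 0 = c' by rewrite /s3 /update /= sc P2.
    have bs3 : base x s3 by apply: base_same f3 _ bs2.
    have M4 : mark_inv ([set c; c'] :: ML2) (run mark s3).
      by apply: mark_spec; rewrite ?[A c c']adj_sym.
    set s4 := run mark s3 in M4 *.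
    have s4E : s4 EB = s3 EB by rewrite /s4 run_same.
    exists ([set c; c'] :: ML2), c', ([set c; c'] |: S); split.
    - by rewrite update_eq /= s4E sB.
    - by right; case: Dc => Dc; [rewrite Dc in Dc0|rewrite /D in Dc lc *; lia].
    - by rewrite /D in Dck lc *; lia.
    - split; [by apply: suffix_trans sM _; apply: suffix_cons| |].
        by rewrite /= /D in zM lc *; lia.
      by case: M4 => *; split=> *; rewrite ?update_neq.
    split.
    + by move=> e; rewrite !inE => /predU1P[->|/SM ->]; rewrite ?eqxx ?orbT.
    + apply: leq_trans zS; rewrite cardsU1.
      case: (_ \notin S); rewrite /= ?add0n ?leq_add2l ?(ltnW lc) //.
      by rewrite addnAC addnC leq_add2l.
    apply: (@connect_trans _ _ c).
      by apply: connect1; rewrite /span setUC !inE eqxx.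
    by apply: sub_connect_span cS; apply: subsetUr.
  exists ML, z, set0; split=> //.
  - by right; rewrite addn0.
  - split; [exact: suffix_refl|by []|].
    by case: JM => *; split=> *; rewrite ?f1.
  by split; [move=> e; rewrite inE | rewrite cards0 | apply: connect0].
rewrite (base_n bs1) => -[ML' [c [S [sc Dc Dck [sM zM M'] [SM zS cS]]]]].
have Dc0 : D c = 0 by rewrite /D in Dc *; lia.
have cu : c = u.
  apply/eqP; apply/negPn/negP => cu; have [z' [_ _]] := di_parent J Dck cu.
  by rewrite -/D Dc0.
exists ML'; split=> //.
  by apply: leq_trans (leq_trans (leq_addr _ _) zM) _; rewrite leq_add2l.
by move=> _ _ _; exists S; rewrite -cu; split=> //; rewrite Dc0 addn0 in zS.
Qed.

End Distances.

Definition linked (u z : 'I_n) (ML : seq {set 'I_n}) :=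
  forall l, l <= minn kap n -> walk A l u z -> exists S : {set {set 'I_n}},
    [/\ {subset S <= ML}, #|S| <= l & connect (span S) u z].

Lemma linked_suffix u z ML ML' : suffix ML ML' -> linked u z ML -> linked u z ML'.
Proof.
move=> sM H l lk /(H l lk)[S [SM Sl cS]]; exists S; split=> // e eS.
exact: suffix_mem sM _ (SM e eS).
Qed.

(** The weights given to [run_for_grow] vanish outside [T], so the bound on the growth does not
    involve [n] although the loops visit all vertices. *)
Lemma links_spec (T : {set 'I_n}) s ML : base x s -> mark_inv ML s ->
    (forall i : 'I_n, (s TERM i != 0) = (i \in T)) ->
  exists ML', [/\ size ML' <= size ML + #|T| * (#|T| * kap),
    suffix ML ML',
    forall u z, u \in T -> z \in T -> linked u z ML' & mark_inv ML' (run links s)].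
Proof.
move=> bs JM sT.
have sumT c : \sum_(i < n) (if i \in T then c else 0) = #|T| * c.
  by rewrite -big_mkcond /= sum_nat_const.
suff [ML' [? ? ? ?]] : exists ML', [/\ suffix ML ML',
    size ML' <= size ML + \sum_(i < n) (if i \in T then #|T| * kap else 0),
    forall u, u \in T -> forall z, z \in T -> linked u z ML'
    & mark_inv ML' (run links s)].
  by exists ML'; split=> //; [rewrite -sumT | move=> u z uT zT; auto].
apply: (run_for_grow (H := fun u ML => u \in T -> forall z, z \in T -> linked u z ML))
  JM => //.
- exact: base_n bs.
- by move=> M1 s1 v [? ? ?]; split.
- by move=> u M1 M2 sM H uT z zT; apply: linked_suffix sM (H uT z zT).
move=> u s1 ML1 Hs s1U M1.
have bs1 : base x s1 by apply: base_same Hs _ bs.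
have T1 : s1 TERM = s TERM by rewrite Hs.
rewrite run_when [eval _ _]/= s1U T1 sT.
case: ifP => uT; last first.
  by exists ML1; split=> //; [exact: suffix_refl|exact: leq_addr].
rewrite 2!run_seqs run_seqs0; set s2 := run distances s1.
have f2 : same _ s2 s1 := @run_same _ _.
have bs2 : base x s2 by apply: base_same f2 _ bs1.
have [J2 H2] : dist_inv u s2 /\ forall l (y : 'I_n), l <= n -> walk A l u y ->
    s2 DIST y <= l by apply: distances_spec.
have M2 : mark_inv ML1 s2 by case: M1 => *; split=> *; rewrite ?f2.
pose K (ML : seq {set 'I_n}) (s : store) := mark_inv ML s /\ dist_inv u s.
suff [ML' [sM zM HM [M' _]]] : exists ML', [/\ suffix ML1 ML',
    size ML' <= size ML1 + \sum_(i < n) (if i \in T then kap else 0),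
    forall z, z \in T -> linked u z ML' & K ML' (run (PFor Z trace) s2)].
  by exists ML'; split=> //; rewrite -sumT.
apply: (run_for_grow (J := K) (H := fun z ML => z \in T -> linked u z ML)) => //.
- exact: base_n bs2.
- by move=> M3 s3 v [[? ? ?] ?]; split=> //; apply: dist_inv_var.
- by move=> z M3 M4 sM H zT; apply: linked_suffix sM (H zT).
move=> z s3 ML3 Hs3 s3Z [M3 J3].
have bs3 : base x s3 by apply: base_same Hs3 _ bs2.
have T3 : s3 TERM = s TERM by rewrite Hs3 // f2.
have D3 : s3 DIST = s2 DIST by rewrite Hs3.
have [ML' [sM zM HM M']] := trace_spec bs3 J3 M3 s3Z.
exists ML'; split=> //; first by rewrite T3 sT in zM.
  rewrite T3 sT in HM => /HM H l; rewrite leq_min => /andP[lk ln] uz.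
  have Dl : s3 DIST z <= l by rewrite D3; apply: H2.
  have [||S [SM Sl cS]] := H; try exact: leq_trans Dl _.
  by exists S; split=> //; apply: leq_trans Dl.
split=> //; case: J3 => H3 H4; have f4 := @run_same trace s3.
by split; rewrite ?f4.
Qed.

End Links.

(** * The program: output *)

Definition incr a := set_var a (Add (var a) (Cst 1)).

Definition for_used a p := PFor a (PWhen (Get USED (var a)) p).

Definition emit e := PSeq (PPut 1 (Add (var LEN) (Cst 1)) e) (incr LEN).

(** A kept pair is recorded in one order, with each edge in increasing order, hence eight cells to
    inspect; [1 - (1 - a)] turns their sum into a truth value. *)
Definition kept_expr :=
  let K a b c d := Get KEPT (idx4 (var a) (var b) (var c) (var d)) in
  let K4 a b c d :=
    Add (Add (K a b c d) (K b a c d)) (Add (K a b d c) (K b a d c)) in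
  Defs.Sub (Cst 1) (Defs.Sub (Cst 1) (Add (K4 X Y Z W) (K4 Z W X Y))).

Definition count_used := for_used X (seqs
  [:: incr NV; PWhen (Defs.Sub (Get 0 (Cst 2)) (var X)) (incr SI);
      PWhen (Defs.Sub (Get 0 (Cst 3)) (var X)) (incr TI)]).

Definition output := seqs
  [:: count_used; emit (var NV); emit (var SI); emit (var TI); emit (var KP);
      for_used X (for_used Y (emit (Get MARK (idx2 (var X) (var Y)))));
      for_used X (for_used Y (for_used Z (for_used W (emit kept_expr))));
      PPut 1 (Cst 0) (var LEN)].

Definition emitted (w : seq nat) (s : store) :=
  s LEN 0 = size w /\ forall i, i < size w -> s 1 i.+1 = nth 0 w i.

Lemma emit_spec e w s :
  emitted w s -> emitted (rcons w (eval s e)) (run (emit e) s).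
Proof.
move=> [H1 H2]; rewrite /emit run_seq /incr /set_var !run_put.
split; first by rewrite update_eq /= update_neq // size_rcons H1 addn1.
move=> i; rewrite size_rcons ltnS nth_rcons update_neq // update_eq /= H1 addn1 eqSS.
by case: ltngtP => // lt _; apply: H2.
Qed.

Lemma count_lt_index m (s : seq 'I_m) v :
  sorted (fun a b : 'I_m => a < b) s -> v \in s ->
  count (fun a : 'I_m => a < v) s = index v s.
Proof.
have tr : transitive (fun a b : 'I_m => a < b) by move=> b a c; apply: ltn_trans.
elim: s => //= a s IH; rewrite (path_sortedE tr).
case/andP=> /allP as1 ss; rewrite inE eq_sym.
case: eqP => [E _|_ /= vs].
  subst v.
  rewrite ltnn (eq_in_count (a2 := pred0)) ?count_pred0 // => b /as1 ab.
  by rewrite ltnNge (ltnW ab).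
by rewrite (as1 _ vs) IH.
Qed.

Lemma sorted_enum m (P : pred 'I_m) :
  sorted (fun a b : 'I_m => a < b) [seq v <- enum 'I_m | P v].
Proof.
apply: sorted_filter; first by move=> b c d; apply: ltn_trans.
by have := iota_ltn_sorted 0 m; rewrite -val_enum_ord sorted_map.
Qed.

Lemma take_enum m (i : 'I_m) : take i.+1 (enum 'I_m) = rcons (take i (enum 'I_m)) i.
Proof. by rewrite (take_nth i) ?size_enum_ord // nth_ord_enum. Qed.

Section Output.
Variable x : spfg.
Let n := nvertices x.
Notation G := (graph x).
Notation A := (adj G).
Notation kap := (kappa x).
Notation ix2 := (@ix2 x).
Notation ix4 := (@ix4 x).

Variables (used : pred 'I_n) (L : seq ({set 'I_n} * {set 'I_n})).
Variable (ML : seq {set 'I_n}).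
Let Vs := [seq v <- enum 'I_n | used v].

Lemma for_used_spec (h : 'I_n -> seq nat) a p w s :
    s 0 1 = n -> wf (PFor a p) -> a != 1 -> a != LEN -> a != USED ->
    USED \notin writes p ->
    (forall v : 'I_n, s USED v = used v) ->
    (forall (i : 'I_n) s1 w1, same (a :: writes p) s1 s -> s1 a 0 = i ->
       emitted w1 s1 -> emitted (w1 ++ h i) (run p s1)) ->
  emitted w s -> emitted (w ++ flatten [seq h i | i <- Vs]) (run (for_used a p) s).
Proof.
move=> s01 wfp a1 aL aU pU sU Hp Hw.
pose I m s' := emitted
  (w ++ flatten [seq h i | i <- [seq v <- take m (enum 'I_n) | used v]]) s'.
have: I (s 0 1) (run (for_used a p) s); last first.
  by rewrite /I s01 take_oversize // size_enum_ord.
apply: (@run_for I) => //; last by rewrite /I take0 cats0.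
  by move=> i s1 v; rewrite /I /emitted !update_neq // eq_sym.
rewrite s01 => i s1 lti Hs s1a; pose j : 'I_n := Ordinal lti.
rewrite /I -[i]/(j : nat) take_enum filter_rcons run_when [eval _ _]/= s1a.
have -> : s1 USED i = used j.
  by rewrite Hs; [exact: (sU j) | rewrite inE negb_or eq_sym aU].
case: (used j) => //= Iw.
rewrite map_rcons flatten_rcons catA; apply: Hp => //.
Qed.

Definition used_inv s := [/\ base x s, forall v : 'I_n, s USED v = used v,
  forall a b : 'I_n, s MARK (ix2 a b) = ([set a; b] \in ML) &
  forall i j i' j' : 'I_n, s KEPT (ix4 i j i' j') =
    [&& i < j, i' < j' & ([set i; j], [set i'; j']) \in L]].

Lemma used_inv_same ws s s' : same ws s s' ->
  all (fun b => b \notin ws)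
    [:: 0; R1; R2; R3; N2; KP; CAP; USED; MARK; KEPT] ->
  used_inv s' -> used_inv s.
Proof.
move=> Hs; rewrite (@all_cat _ _ [:: 0; R1; R2; R3; N2; KP; CAP]).
case/andP=> w1 /= /and4P[/Hs HU /Hs HM /Hs HK _] [bs H1 H2 H3].
by split; [exact: base_same Hs w1 bs|rewrite HU|rewrite HM|rewrite HK].
Qed.

Hypothesis (LE : {subset touched L <= edges G}).

(** When two indices coincide, both sides are false: a singleton is not an edge, whereas touched
    sets are. *)
Lemma kept_swaps (i j i' j' : 'I_n) :
  let k (i j i' j' : 'I_n) :=
    [&& i < j, i' < j' & ([set i; j], [set i'; j']) \in L] in
  kept L [set i; j] [set i'; j'] =
  [|| k i j i' j', k j i i' j', k i j j' i', k j i j' i',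
      k i' j' i j, k j' i' i j, k i' j' j i | k j' i' j i].
Proof.
have nkept (a : 'I_n) e : kept L [set a; a] e = false.
  apply/negP=> H; have /LE : [set a; a] \in touched L by apply/touchedP; exists e.
  by rewrite in_edges adj_irr.
rewrite /= [[set j; i]]setUC [[set j'; i']]setUC.
case: (ltngtP i j) => [ij|ij|/val_inj->]; case: (ltngtP i' j') => [ij'|ij'|/val_inj->];
  rewrite /= ?orbF ?nkept // ?[kept L _ [set _; j']]keptC ?nkept //.
Qed.

Lemma eval_kept s (i j i' j' : 'I_n) : used_inv s ->
    s X 0 = i -> s Y 0 = j -> s Z 0 = i' -> s W 0 = j' ->
  eval s kept_expr = kept L [set i; j] [set i'; j'].
Proof.
move=> [bs _ _ HK] sX sY sZ sW; rewrite kept_swaps.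
have E a b c d (i1 i2 i3 i4 : 'I_n) :
    s a 0 = i1 -> s b 0 = i2 -> s c 0 = i3 -> s d 0 = i4 ->
  eval s (Get KEPT (idx4 (var a) (var b) (var c) (var d))) =
    [&& i1 < i2, i3 < i4 & ([set i1; i2], [set i3; i4]) \in L].
  move=> *; rewrite -HK -[LHS]/(s KEPT (eval s (idx4 (var a) (var b) (var c) (var d)))).
  by rewrite (@eval_idx4 _ _ _ _ _ _ i1 i2 i3 i4).
have evalD a b : eval s (Add a b) = eval s a + eval s b by [].
have evalB a b : eval s (Defs.Sub a b) = eval s a - eval s b by [].
rewrite /kept_expr !evalB !evalD.
rewrite (E X Y Z W i j i' j') // (E Y X Z W j i i' j') // (E X Y W Z i j j' i') //.
rewrite (E Y X W Z j i j' i') // (E Z W X Y i' j' i j) // (E W Z X Y j' i' i j) //.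
rewrite (E Z W Y X i' j' j i) // (E W Z Y X j' i' j i) //.
by do 8! case: [&& _, _ & _].
Qed.

Lemma count_used_spec s : used_inv s -> used (source x) -> used (target x) ->
    s NV 0 = 0 -> s SI 0 = 0 -> s TI 0 = 0 ->
  let s' := run count_used s in
  [/\ s' NV 0 = size Vs, s' SI 0 = index (source x) Vs
    & s' TI 0 = index (target x) Vs].
Proof.
move=> [bs sU _ _] us ut sN sS sT; set s' := run _ s.
pose I m s' := let V := [seq v <- take m (enum 'I_n) | used v] in
  [/\ s' NV 0 = size V, s' SI 0 = count (fun v : 'I_n => v < source x) V
    & s' TI 0 = count (fun v : 'I_n => v < target x) V].
have: I (s 0 1) s'; last first.
  have inVs v : used v -> v \in Vs by move=> uv; rewrite mem_filter uv mem_enum.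
  have sVs := sorted_enum used.
  rewrite (base_n bs) /I take_oversize ?size_enum_ord // => -[-> -> ->].
  by rewrite !count_lt_index // inVs.
apply: (@run_for I) => //; last by rewrite /I take0.
rewrite (base_n bs) => i s1 lti Hs s1X [I1 I2 I3]; pose j : 'I_n := Ordinal lti.
rewrite /I -[i]/(j : nat) take_enum filter_rcons run_when [eval _ _]/= s1X.
rewrite Hs // -[i]/(j : nat) sU; case: (used j) => //=.
have i2 : s1 0 2 = source x by rewrite Hs // (baseI bs).
have i3 : s1 0 3 = target x by rewrite Hs // (baseI bs).
rewrite -cats1 size_cat !count_cat /= !addn0 addn1.
rewrite 3!run_seqs run_seqs0 !run_when.
rewrite /incr /set_var !run_put.
set s2 := update s1 NV _ _.
have f2 b : b != NV -> s2 b = s1 b by move=> bN; rewrite /s2 update_neq.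
have s2N : s2 NV 0 = (s1 NV 0).+1 by rewrite /s2 update_eq /= addn1.
rewrite [eval s2 (Defs.Sub _ _)]/= !f2 // i2 s1X subn_eq0 -ltnNge.
set s3 := if i < source x then _ else _.
have s3S : s3 SI 0 = s1 SI 0 + (i < source x).
  by rewrite /s3; case: ifP => _; rewrite ?update_eq /= f2 // ?addn0.
have f3 b : b != SI -> s3 b = s2 b.
  by move=> bS; rewrite /s3; case: ifP => _; rewrite ?update_neq.
rewrite [eval s3 (Defs.Sub _ _)]/= !f3 // !f2 // i3 s1X subn_eq0 -ltnNge.
set s4 := if i < target x then _ else _.
have s4T : s4 TI 0 = s1 TI 0 + (i < target x).
  by rewrite /s4; case: ifP => _; rewrite ?update_eq /= f3 // f2 // ?addn0.
have f4 b : b != TI -> s4 b = s3 b.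
  by move=> bT; rewrite /s4; case: ifP => _; rewrite ?update_neq.
by rewrite f4 // f3 // s2N I1 f4 // s3S I2 s4T I3.
Qed.

(** The nested concatenations of singletons follow the nested loops of [output], one application of
    [for_used_spec] per level. *)
Definition out_word := [:: size Vs; index (source x) Vs; index (target x) Vs; kap]
  ++ flatten [seq flatten [seq [:: ([set a; b] \in ML) : nat] | b <- Vs] | a <- Vs]
  ++ flatten [seq flatten [seq flatten [seq flatten [seq
       [:: kept L [set a; b] [set c; d] : nat]
     | d <- Vs] | c <- Vs] | b <- Vs] | a <- Vs].

Lemma output_spec s : used_inv s -> used (source x) -> used (target x) ->
    s NV 0 = 0 -> s SI 0 = 0 -> s TI 0 = 0 -> s LEN 0 = 0 ->
  array_holds (run output s 1) out_word.
Proof.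
move=> J us ut sN sS sT sL; rewrite /output 8!run_seqs run_seqs0.
have [c1 c2 c3] := count_used_spec J us ut sN sS sT.
set s1 := run count_used s in c1 c2 c3 *.
have f1 : same _ s1 s := @run_same _ _.
have J1 : used_inv s1 by apply: used_inv_same f1 _ J.
have w1 : emitted [::] s1 by split=> //; rewrite f1.
set s2 := run (emit (var NV)) s1; have f2 : same _ s2 s1 := @run_same _ _.
have w2 := emit_spec (var NV) w1; rewrite -/s2 /= c1 in w2.
set s3 := run (emit (var SI)) s2; have f3 : same _ s3 s2 := @run_same _ _.
have w3 := emit_spec (var SI) w2; rewrite -/s3 /= f2 // c2 in w3.
set s4 := run (emit (var TI)) s3; have f4 : same _ s4 s3 := @run_same _ _.
have w4 := emit_spec (var TI) w3; rewrite -/s4 /= f3 // f2 // c3 in w4.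
set s5 := run (emit (var KP)) s4; have f5 : same _ s5 s4 := @run_same _ _.
have w5 := emit_spec (var KP) w4; rewrite -/s5 /= f4 // f3 // f2 // in w5.
have [bs1 _ _ _] := J1; rewrite (baseKP bs1) in w5.
have J5 : used_inv s5.
  apply: used_inv_same f5 _ _ => //; apply: used_inv_same f4 _ _ => //.
  by apply: used_inv_same f3 _ _ => //; apply: used_inv_same f2 _ _.
set w0 := [:: _; _; _; _] in w5.
pose wa0 := flatten
  [seq flatten [seq [:: ([set a; b] \in ML) : nat] | b <- Vs] | a <- Vs].
pose wf0 := flatten [seq flatten [seq flatten [seq flatten [seq
  [:: kept L [set a; b] [set c; d] : nat] | d <- Vs] | c <- Vs] | b <- Vs] | a <- Vs].
have wE : out_word = (w0 ++ wa0) ++ wf0 by rewrite -catA.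
set s6 := run (for_used X _) s5.
have f6 : same _ s6 s5 := @run_same _ _.
have J6 : used_inv s6 by apply: used_inv_same f6 _ J5.
set s7 := run (for_used X _) s6.
have w6 : emitted (w0 ++ wa0) s6.
  have [b5 U5 _ _] := J5.
  apply: (@for_used_spec
      (fun a => flatten [seq [:: ([set a; b] \in ML) : nat] | b <- Vs]))
    w5 => //; first exact: base_n b5.
  move=> a sa wa Hs sX wwa; have Ja : used_inv sa by apply: used_inv_same Hs _ J5.
  have [ba Ua _ _] := Ja.
  apply: (@for_used_spec (fun b => [:: ([set a; b] \in ML) : nat])) wwa => //.
    exact: base_n ba.
  move=> b sb wb Hsb sY wwb; have Jb : used_inv sb by apply: used_inv_same Hsb _ Ja.
  have [bb _ Mb _] := Jb.
  rewrite cats1 -Mb -(@eval_idx2 x sb (var X) (var Y)) //; last by rewrite /= Hsb.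
  exact: (emit_spec (Get MARK (idx2 (var X) (var Y)))).
have w7 : emitted ((w0 ++ wa0) ++ wf0) s7.
  have [b6 U6 _ _] := J6.
  apply: (@for_used_spec (fun a => flatten [seq flatten [seq flatten [seq
       [:: kept L [set a; b] [set c; d] : nat] | d <- Vs] | c <- Vs] | b <- Vs]))
    w6 => //; first exact: base_n b6.
  move=> a sa wa Hs sX wwa; have Ja : used_inv sa by apply: used_inv_same Hs _ J6.
  have [ba Ua _ _] := Ja.
  apply: (@for_used_spec (fun b => flatten [seq flatten [seq
       [:: kept L [set a; b] [set c; d] : nat] | d <- Vs] | c <- Vs])) wwa => //.
    exact: base_n ba.
  move=> b sb wb Hsb sY wwb; have Jb : used_inv sb by apply: used_inv_same Hsb _ Ja.
  have [bb Ub _ _] := Jb.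
  apply: (@for_used_spec (fun c => flatten [seq
       [:: kept L [set a; b] [set c; d] : nat] | d <- Vs])) wwb => //.
    exact: base_n bb.
  move=> c sc wc Hsc sZ wwc; have Jc : used_inv sc by apply: used_inv_same Hsc _ Jb.
  have [bc Uc _ _] := Jc.
  apply: (@for_used_spec (fun d => [:: kept L [set a; b] [set c; d] : nat])) wwc => //.
    exact: base_n bc.
  move=> d sd wd Hsd sW wwd; have Jd : used_inv sd by apply: used_inv_same Hsd _ Jc.
  rewrite cats1 -(@eval_kept sd a b c d) //; first exact: emit_spec.
  - by rewrite Hsd // Hsc // Hsb.
  - by rewrite Hsd // Hsc.
  by rewrite Hsd.
rewrite -wE in w7; case: w7 => zw nw.
rewrite run_put => -[|i] H; first by rewrite update_eq /= zw.
by rewrite update_eq /= nw.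
Qed.

End Output.

(** * The kernel *)

Lemma card_edge (V : finType) (G : sgraph V) e : e \in edges G -> #|e| <= 2.
Proof.
rewrite inE => /existsP[u /existsP[v /andP[_ /eqP->]]].
by rewrite cards2; case: (_ != _).
Qed.

Lemma size_ends (V : finType) (G : sgraph V) (ML : seq {set V}) (us : seq V) s t :
    {subset ML <= edges G} -> uniq us ->
    (forall v, v \in us -> [|| v == s, v == t | has (fun e : {set V} => v \in e) ML]) ->
  size us <= 2 + 2 * size ML.
Proof.
move=> ME uus usE; set ends := s :: t :: flatten [seq enum e | e : {set V} <- ML].
have zends : size ends <= 2 + 2 * size ML.
  rewrite /= add2n !ltnS; elim: ML ME {usE ends} => //= e ML IH ME.
  rewrite size_cat mulnS -cardE leq_add ?(card_edge (ME _ (mem_head _ _))) //.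
  by apply: IH => e' e'ML; apply: ME; rewrite inE e'ML orbT.
apply: leq_trans zends; apply: uniq_leq_size => // v /usE.
rewrite !inE => /or3P[->|->|/hasP[e eML ve]]; rewrite ?orbT //.
apply/orP; right; apply/orP; right; apply/flattenP.
exists (enum e); last by rewrite mem_enum.
by apply: map_f.
Qed.

Lemma size_touched (T : finType) (L : seq (T * T)) : #|touched L| <= 2 * size L.
Proof.
rewrite mul2n -addnn -{1}(size_map fst L) -(size_map snd L) -size_cat.
apply: leq_trans (card_size _); apply/subset_leq_card/subsetP => e.
rewrite inE -has_count => /hasP[c cL /orP[]/eqP<-]; rewrite mem_cat.
  by rewrite map_f.
by rewrite [X in _ || X]map_f ?orbT.
Qed.

Lemma flatten_map_allpairs (A B : Type) (g : A * B -> seq nat) s t :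
  flatten [seq g p | p <- [seq (a, b) | a <- s, b <- t]] =
  flatten [seq flatten [seq g (a, b) | b <- t] | a <- s].
Proof.
elim: s => //= a s IH; rewrite map_cat flatten_cat IH -map_comp; congr (_ ++ _).
Qed.

Lemma flatten_singletons (A : Type) (g : A -> nat) s :
  [seq g a | a <- s] = flatten [seq [:: g a] | a <- s].
Proof. by elim: s => //= a s ->. Qed.

Section Kernel.
Variable x : spfg.
Let n := nvertices x.
Notation G := (graph x).
Notation s := (source x).
Notation t := (target x).
Notation kap := (kappa x).
Variables (L : seq ({set 'I_n} * {set 'I_n})) (ML : seq {set 'I_n}).
Hypotheses (simpleL : simple L) (LM : {subset touched L <= ML}).
Hypothesis ME : {subset ML <= edges G}.

Let used v := [|| v == s, v == t | has (fun e : {set 'I_n} => v \in e) ML].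
Let Vs := [seq v <- enum 'I_n | used v].
Let f := tnth (in_tuple Vs).
Let M := [set e in ML].

Let uniq_Vs : uniq Vs. Proof. exact/filter_uniq/enum_uniq. Qed.

Let f_inj : injective f.
Proof.
move=> i j; rewrite /f !(tnth_nth s) => /eqP.
by rewrite nth_uniq ?ltn_ord // => /eqP/val_inj.
Qed.

Let ME' : M \subset edges G.
Proof. by apply/subsetP=> e; rewrite inE; apply: ME. Qed.

Let LM' : touched L \subset M.
Proof. by apply/subsetP=> e /LM; rewrite inE. Qed.

Let used_codom v : used v -> v \in codom f.
Proof.
move=> uv; have : v \in in_tuple Vs by rewrite mem_filter uv mem_enum.
by case/tnthP=> i ->; apply: codom_f.
Qed.

Let fM e v : e \in M -> v \in e -> v \in codom f.
Proof.
rewrite inE => eM ve; apply: used_codom; apply/or3P; apply: Or33.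
by apply/hasP; exists e.
Qed.

Let used_s : used s. Proof. by rewrite /used eqxx. Qed.
Let used_t : used t. Proof. by rewrite /used eqxx orbT. Qed.

Let index_lt v : used v -> index v Vs < size Vs.
Proof. by move=> uv; rewrite index_mem mem_filter uv mem_enum. Qed.

Let new_s := Ordinal (index_lt used_s).
Let new_t := Ordinal (index_lt used_t).

Let f_index v (uv : used v) : f (Ordinal (index_lt uv)) = v.
Proof. by rewrite /f (tnth_nth s) /= nth_index // -index_mem index_lt. Qed.

Let new_s_neq_t : new_s != new_t.
Proof.
apply: contraNneq (source_neq_target x) => E.
by rewrite -(f_index used_s) -(f_index used_t) -/new_s -/new_t E.
Qed.

Let kap_gt0 : 0 < kap.
Proof.
rewrite leq_min budget_gt0 muln_gt0 andbb.
exact: leq_ltn_trans (leq0n s) (ltn_ord s).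
Qed.

Definition kernel := @SPFG (size Vs) (restricted_graph ME' f) new_s new_t
  new_s_neq_t kap kap_gt0 (restricted_forcing ME' simpleL f).

(** Both sides list the used vertices in increasing order, as [f] enumerates [Vs]; entries agree
    because [f] maps [[set i; j]] to [[set f i; f j]]. *)
Lemma kernel_encode : spfg_encode kernel = out_word used L ML.
Proof.
have imE (i j : 'I_(size Vs)) : f @: [set i; j] = [set f i; f j].
  by rewrite imsetU1 imset_set1.
have VsE (h : 'I_n -> seq nat) :
    [seq h v | v <- Vs] = [seq h (f i) | i <- enum 'I_(size Vs)].
  by rewrite -[Vs in LHS](map_tnth_enum (in_tuple Vs)) -map_comp.
rewrite /spfg_encode /out_word -/Vs; congr (_ ++ (_ ++ _)).
  rewrite flatten_singletons flatten_map_allpairs VsE.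
  congr flatten; apply: eq_map => i; rewrite VsE.
  by congr flatten; apply: eq_map => j; rewrite /= inE.
rewrite (_ : [seq _ | p <- _, q <- _] = flatten [seq flatten [seq
   [:: kept L [set f p.1; f p.2] [set f q.1; f q.2] : nat]
   | q <- [seq (i, j) | i <- enum 'I_(size Vs), j <- enum 'I_(size Vs)]]
   | p <- [seq (i, j) | i <- enum 'I_(size Vs), j <- enum 'I_(size Vs)]]).
  rewrite flatten_map_allpairs VsE; congr flatten; apply: eq_map => i.
  rewrite VsE; congr flatten; apply: eq_map => j.
  rewrite flatten_map_allpairs VsE; congr flatten; apply: eq_map => i'.
  by rewrite VsE.
congr flatten; apply: eq_map => p; rewrite flatten_singletons.
congr flatten; apply: eq_map => q; congr [:: nat_of_bool _].
by rewrite -!imE -(forced_restricted ME' simpleL LM' f_inj fM).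
Qed.

Lemma kernel_yes : spfg_yes kernel <-> solution M (kept L) s t kap.
Proof.
rewrite spfg_yesP (solution_restricted ME' simpleL LM' f_inj fM).
by rewrite /= !f_index.
Qed.

Lemma kernel_size : spfg_size kernel <= 2 + 3 * size ML + size L.
Proof.
have H1 : size Vs <= 2 + 2 * size ML.
  apply: (@size_ends _ _ _ _ s t ME uniq_Vs) => v.
  by rewrite mem_filter => /andP[].
have H2 : #|edges (restricted_graph ME' f)| <= size ML.
  apply: leq_trans (card_edges_restricted ME' f_inj fM) _.
  by rewrite /M cardsE card_size.
have H3 : #|edges (restricted_forcing ME' simpleL f)| <= size L.
  exact: card_edges_restricted_forcing.
rewrite /spfg_size /=; apply: leq_trans (leq_add (leq_add H1 H2) H3) _; lia.
Qed.

End Kernel.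

(** For [k >= 1] one gets [l <= 3 * k ^ 2], [F <= 6 * k ^ 2], [T <= 14 * k ^ 2] and
    [m <= 202 * k ^ 5], so the sum is at most [612 * k ^ 5]; 1000 is a round upper bound. *)
Lemma kernel_bound k l F T m :
    0 < k -> l <= (k.+1 * k).+1 -> F <= 2 * l -> T <= 2 + 2 * F ->
    m <= F + T * (T * k) ->
  2 + 3 * m + l + k <= 1000 * k ^ 5.
Proof.
move=> k0 Hl HF HT Hm.
have l3 : l <= 3 * k ^ 2 by rewrite expnS expn1; nia.
have k25 : k ^ 2 <= k ^ 5 by rewrite leq_pexp2l.
have k15 : k <= k ^ 5 by rewrite -{1}[k]expn1 leq_pexp2l.
have T14 : T <= 14 * k ^ 2.
  have : 0 < k ^ 2 by rewrite expn_gt0 k0.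
  by move: l3; move: (k ^ 2) => q; lia.
have TT : T * (T * k) <= 196 * k ^ 5.
  rewrite (_ : 196 * k ^ 5 = (14 * k ^ 2) * ((14 * k ^ 2) * k)).
    by apply: leq_mul => //; apply: leq_mul.
  by rewrite !expnS expn0; lia.
by move: TT T14 l3 k15 k25; move: (k ^ 2) (k ^ 5) (T * (T * k)) Hm => *; lia.
Qed.

(** * Correctness, size and running time of the whole program *)

Definition program :=
  seqs [:: initialize; greedy; mark_ends; mark_touched; copy_terminals; links; output].

Lemma program_spec (x : spfg) : exists y : spfg,
  [/\ array_holds (run program (initial_store (spfg_encode x)) 1) (spfg_encode y),
      spfg_yes x <-> spfg_yes y
    & spfg_size y + budget y <= 1000 * budget x ^ 5].
Proof.
set n := nvertices x; set kap := kappa x.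
set s0 := initial_store _.
have z0 a i : a != 0 -> s0 a i = 0 by rewrite /s0 /initial_store => /negbTE ->.
rewrite /program 7!run_seqs run_seqs0.
set s1 := run initialize s0; have f1 : same _ s1 s0 := @run_same _ _.
have b1 : base x s1 by apply: initialize_base.
have g1 : @greedy_inv x [::] s1.
  by split=> //= *; rewrite f1 // z0 // ?andbF ?if_same.
have [L [Ldone gL]] := greedy_spec b1 g1.
set s2 := run greedy s1 in gL *; have f2 : same _ s2 s1 := @run_same _ _.
have b2 : base x s2 by apply: base_same f2 _ b1.
set s3 := run mark_ends s2; have f3 : same _ s3 s2 := @run_same _ _.
have b3 : base x s3 by apply: base_same f3 _ b2.
have m3 : @mark_inv x [::] s3.
  by apply: mark_ends_spec => // i; rewrite f2 // f1 // z0.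
have LE : {subset touched L <= edges (graph x)}.
  move=> e /touchedP[e' /orP[]/(gi_forced gL) /=]; last rewrite forcedC.
    exact: forced_edges.
  exact: forced_edges.
set s4 := run mark_touched s3; have f4 : same _ s4 s3 := @run_same _ _.
have b4 : base x s4 by apply: base_same f4 _ b3.
have m4 : mark_inv (enum (touched L)) s4.
  apply: mark_touched_spec => //; split=> // i j.
  by rewrite f3 // (gi_DEG gL).
set s5 := run copy_terminals s4; have f5 : same _ s5 s4 := @run_same _ _.
have b5 : base x s5 by apply: base_same f5 _ b4.
have T5 (i : 'I_n) : s5 TERM i = s4 USED i.
  pose I j s' := s' USED = s4 USED /\ forall i : 'I_n, i < j -> s' TERM i = s4 USED i.
  suff [_ H] : I (s4 0 1) s5 by apply: H; rewrite (base_n b4) ltn_ord.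
  apply: (@run_for I) => // j s' ltj Hs sX [H1 H2]; split=> // i'.
  rewrite ltnS leq_eqVlt run_put update_eq [eval _ (var _)]/= sX.
  by case: eqP => [E _|_ /= /H2 //]; rewrite /= sX H1 E.
have m5 : mark_inv (enum (touched L)) s5.
  by case: m4 => *; split=> *; rewrite ?f5.
pose T := [set i : 'I_n | s5 TERM i != 0].
have [|ML [zML sML linkML m6]] := @links_spec x T s5 _ b5 m5.
  by move=> i; rewrite inE.
set s6 := run links s5 in m6 *; have f6 : same _ s6 s5 := @run_same _ _.
have LM : {subset touched L <= ML}.
  by move=> e eL; apply: (suffix_mem sML); rewrite mem_enum.
pose y := kernel (gi_simple gL) (mi_edges m6).
have inT v : (v \in T) = [|| v == source x, v == target x
    | has (fun e : {set 'I_n} => v \in e) (enum (touched L))].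
  by rewrite inE T5 (mi_USED m4) eqb0 negbK.
exists y; split.
- rewrite kernel_encode //.
  refine (@output_spec x _ L ML LE s6 _ _ _ _ _ _ _).
  + split; [by apply: base_same f6 _ b5|exact: mi_USED m6|exact: mi_MARK m6|].
    move=> i j i' j'; rewrite f6 // f5 // f4 // f3 //; exact: gi_KEPT gL _ _ _ _.
  + by rewrite eqxx.
  + by rewrite eqxx orbT.
  + by rewrite f6 // f5 // f4 // f3 // f2 // f1 // z0.
  + by rewrite f6 // f5 // f4 // f3 // f2 // f1 // z0.
  + by rewrite f6 // f5 // f4 // f3 // f2 // f1 // z0.
  + by rewrite f6 // f5 // f4 // f3 // f2 // f1 // z0.
- rewrite spfg_yesP kernel_yes //.
  apply: (@solution_kernel _ (adj (graph x)) _ _ T _ _ _ _ _ (n * n)) => //.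
  + by move=> u v; rewrite in_edges.
  + by apply/subsetP=> e; rewrite in_set => eML; apply: (mi_edges m6).
  + exact: card_edges.
  + exact: forcedC.
  + exact: gi_forced gL.
  + exact: gi_simple gL.
  + exact: gi_degree gL.
  + move=> e e' ee'.
    have := forced_edges ee'; have : e' \in edges (graph x).
      by move: ee'; rewrite forcedC; apply: forced_edges.
    have orient e1 : e1 \in edges (graph x) ->
        exists i j : 'I_n, i < j /\ e1 = [set i; j].
      rewrite inE => /existsP[i /existsP[j /andP[ij /eqP->]]].
      case: (ltngtP i j) => [lt|lt|/val_inj E]; first by exists i, j.
        by exists j, i; rewrite setUC.
      by rewrite E adj_irr in ij.
    move=> /orient[i' [j' [ij' E']]] /orient[i [j [ij E]]].
    by rewrite E E' in ee' *; apply: Ldone.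
  + by apply/subsetP=> e /LM; rewrite inE.
  + by rewrite inT eqxx.
  + by rewrite inT eqxx orbT.
  + move=> u v uv; rewrite inT; apply/or3P; apply: Or33; apply/hasP.
    by exists [set u; v]; rewrite ?mem_enum ?set21.
  move=> u v l uT vT; rewrite card_ord => lk uv.
  have [S [SM Sl cS]] := linkML u v uT vT l lk uv.
  by exists S; split=> //; apply/subsetP=> e /SM; rewrite inE.
have ysize : spfg_size y <= 2 + 3 * size ML + size L by apply: kernel_size.
have zL : size L <= (kap.+1 * kap).+1 := gi_size gL.
have zF : size (enum (touched L)) <= 2 * size L by rewrite -cardE size_touched.
have zT : #|T| <= 2 + 2 * size (enum (touched L)).
  rewrite cardE.
  apply: (@size_ends _ _ _ _ (source x) (target x) (mi_edges m5) (enum_uniq _)) => v.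
  by rewrite mem_enum inT.
have k0 : 0 < kap by apply: (budget_gt0 y).
have kb : kap <= budget x by apply: geq_minl.
have yb : budget y = kap by [].
apply: (@leq_trans (1000 * kap ^ 5)); last by rewrite leq_mul2l leq_exp2r.
rewrite yb; apply: leq_trans (kernel_bound k0 zL zF zT zML).
by rewrite leq_add2r.
Qed.

Lemma size_bitsize w : size w <= bitsize w.
Proof.
rewrite /bitsize -sum1_size; apply: leq_sum => a _; exact: ltn0Sn.
Qed.

(** The adjacency matrix is written in full, and each entry has at least one bit; this turns a bound
    polynomial in [n.+1] into one in the input length. *)
Lemma nvertices_bitsize x : (nvertices x).+1 <= bitsize (spfg_encode x).
Proof.
apply: leq_trans (size_bitsize _); rewrite /spfg_encode !size_cat /= size_map.
rewrite size_allpairs size_enum_ord; nia.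
Qed.

Theorem theorem2 :
  admits_kernel spfg_encode budget spfg_yes spfg_size (fun k : nat => k ^ 5).
Proof.
(* The choice does not affect computability: [program] is fixed beforehand and outputs the encoding
   of whichever instance is chosen. *)
pose K x := proj1_sig (constructive_indefinite_description _ (program_spec x)).
have KP x := proj2_sig (constructive_indefinite_description _ (program_spec x)).
exists K; split; last by exists 1000 => x; have [_ _] := KP x.
  have [c [d Hcost]] := cost_poly program.
  exists (compile program), c, d => x.
  have wfp : wf program by [].
  have [t ex tle] := exec_run (initial_store (spfg_encode x)) wfp.
  exists t, (run program (initial_store (spfg_encode x))); split=> //.
    by have [H _ _] := KP x.
  apply: leq_trans tle _; apply: leq_trans (Hcost _) _; apply: leq_trans (leq_addr _ _).
  rewrite leq_mul2l; apply/orP; right.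
  have [->|d0] := posnP d; first by rewrite !expn0.
  by rewrite leq_exp2r //; apply: nvertices_bitsize.
by move=> x; have [_ H _] := KP x.
Qed.
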